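(* Let $\mathcal A$ be a strict $2$-truncated DG-category. Then $\mathcal A$ is an abelian $2$-truncated DG-category if and only if the $2$-category $\mathcal A_{\mathrm{SCG}}$ (with its pre-locally-SCG structure induced by the addition of $\mathcal A$) is a relatively exact $2$-category without condition (a3-1).
   Context: **DG-categories.** Let $k$ be a commutative ring. DG-categories are $k$-linear with cohomological grading (differential $d$ of degree $+1$). All DG-categories $\mathcal A$ are assumed non-positive: $\mathcal A(X,Y)^i=0$ for $i>0$. $\mathcal A$ is strict $2$-truncated if moreover $\mathcal A(X,Y)^i=0$ for $i\le-2$; it is $2$-truncated if $H^i(\mathcal A(X,Y))=0$ for $i\le-2$. A morphism $f$ is closed if $d(f)=0$. $H^0(\mathcal A)$ is the homotopy category. **Abelian $2$-truncated DG-categories.** For a chain map $\varphi:M\to N$ let $\mathrm{Fib}(\varphi)^i=M^i\oplus N^{i-1}$, $d(m,h)=(dm,-\varphi(m)-dh)$. A 3-term homotopy complex $(f,g,h)$ consists of closed degree-$0$ morphisms $f:X\to Y$, $g:Y\to Z$ and a degree $-1$ morphism $h:X\to Z$ with $d(h)=-g\circ f$. It is left exact (a homotopy kernel of $g$) if for every $W$ and $i\le 0$ the map $\mathcal A(W,X)\to \mathrm{Fib}(g\circ-:\mathcal A(W,Y)\to\mathcal A(W,Z))$, $u\mapsto (f\circ u,h\circ u)$, induces an isomorphism on $H^i$. It is right exact (a homotopy cokernel of $f$) if for every $W$ and $i\le0$ the map $\mathcal A(Z,W)\to\mathrm{Fib}(-\circ f:\mathcal A(Y,W)\to\mathcal A(X,W))$,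 $u\mapsto(u\circ g,(-1)^{|u|}u\circ h)$, induces an isomorphism on $H^i$. It is a homotopy short exact sequence if it is both. A closed degree-$0$ morphism $f:X\to Y$ is a $2$-monomorphism if for every $W$, $H^i(f\circ-):H^i(\mathcal A(W,X))\to H^i(\mathcal A(W,Y))$ is injective for $i=-1$ and bijective for $i\le-2$; a $2$-epimorphism is a $2$-monomorphism in $\mathcal A^{\mathrm{op}}$. A $2$-truncated $\mathcal A$ is abelian $2$-truncated if: (i) $H^0(\mathcal A)$ is additive and every closed degree-$0$ morphism has a homotopy kernel and a homotopy cokernel; (ii) every right exact $(f,g,h)$ with $f$ a $2$-monomorphism is homotopy short exact; (iii) every left exact $(f,g,h)$ with $g$ a $2$-epimorphism is homotopy short exact. **The $2$-category $\mathcal A_{\mathrm{SCG}}$.** Objects: those of $\mathcal A$. $1$-cells $X\to Y$: elements of $\mathcal A(X,Y)^0$. $2$-cells $f\Rightarrow g$: elements $\eta\in\mathcal A(X,Y)^{-1}$ with $d(\eta)=g-f$. Composition of $1$-cells is that of $\mathcal A$; vertical composition of $2$-cells is the sum; horizontal composition of $\phi:f\Rightarrow f'$ and $\psi:g\Rightarrow g'$ is $g\circ\phi+\psi\circ f'=g'\circ\phi+\psi\circ f$. Each $\mathcal A_{\mathrm{SCG}}(X,Y)$ with the addition and zero of $\mathcal A$ is a symmetric categorical group (with identity coherence maps), and this makes $\mathcal A_{\mathrm{SCG}}$ a pre-locally-SCG-category. **Relatively exact $2$-categories (after Nakaoka, without (a3-1)).** A symmetric categorical group is a symmetric monoidal category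 $(X,+,0)$ in which every morphism is invertible and every object $a$ has an object $-a$ with a morphism $a+(-a)\to0$. A $(2,1)$-category $\mathbf S$ (all $2$-cells invertible) is a pre-locally-SCG-category if: (A1) each hom-category $\mathbf S(X,Y)$ carries a symmetric categorical group structure with unit $0_{X,Y}$, and $0_{Y,Z}\circ0_{X,Y}=0_{X,Z}$; (A2) for each $1$-cell $f:X\to Y$ the functors $f\circ-:\mathbf S(Z,X)\to\mathbf S(Z,Y)$ and $-\circ f:\mathbf S(Y,Z)\to\mathbf S(X,Z)$ are monoidal, with unit coherence $2$-cells $f\circ0\Rightarrow0$ and $0\circ f\Rightarrow 0$ which are identities when $f$ is itself a zero $1$-cell. It is a locally-SCG-category (without (a3-1)) if: (A3) there is an object $0$ such that for every $X$ and all $1$-cells $f:X\to0$, $g:0\to X$ there is exactly one $2$-cell $f\Rightarrow0_{X,0}$ and exactly one $2$-cell $g\Rightarrow0_{0,X}$; (A4) $\mathbf S$ has binary $2$-products and $2$-coproducts. Here a $2$-product of $A_1,A_2$ is $(P,p_1,p_2)$ such that for all $q_i:X\to A_i$ there are $q:X\to P$ and $2$-cells $\xi_i:p_iq\Rightarrow q_i$, and for any two such factorizations $(q,\xi_i)$, $(q',\xi'_i)$ there is a unique $2$-cell $\eta:q\Rightarrow q'$ with $\xi'_i\cdot(p_i\circ\eta)=\xi_i$; $2$-coproducts are dual. It is a relatively exact $2$-category (without (a3-1)) if moreover: (B1) $\mathbf S$ has $2$-kernels and $2$-cokernels. A $2$-kernel of $f:A\to B$ is $(K,k:K\to A,\varepsilon:f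 k\Rightarrow0)$ such that for every $x:X\to A$ and $\varepsilon':f x\Rightarrow0$ there are $x':X\to K$ and $\underline\varepsilon:kx'\Rightarrow x$ compatible with $\varepsilon,\varepsilon'$ (i.e. $fkx'\Rightarrow fx\Rightarrow0$ equals $fkx'\Rightarrow0x'\Rightarrow0$), and for any two such $(x'_0,\underline\varepsilon_0)$, $(x'_1,\underline\varepsilon_1)$ there is a unique $2$-cell $\xi:x'_0\Rightarrow x'_1$ with $\underline\varepsilon_1\cdot(k\circ\xi)=\underline\varepsilon_0$; $2$-cokernels are dual. (B2) Every faithful $1$-cell $f$ (i.e. $f\circ-:\mathbf S(X,A)\to\mathbf S(X,B)$ is a faithful functor for all $X$), together with the structure $2$-cell of its $2$-cokernel, is the $2$-kernel of its $2$-cokernel. (B3) Every cofaithful $1$-cell $f$ (i.e. $-\circ f$ is faithful for all targets), together with the structure $2$-cell of its $2$-kernel, is the $2$-cokernel of its $2$-kernel. *)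

(* Defs.v *)
From HB Require Import structures.
From mathcomp Require Import all_boot all_order all_algebra.
From mathcomp Require Import boolp.

Set Implicit Arguments.
Unset Strict Implicit.
Unset Printing Implicit Defensive.

Import Order.TTheory GRing.Theory Num.Theory.
Local Open Scope ring_scope.
Local Open Scope quotient_scope.

(* Degree bookkeeping: a degree that is only propositionally equal to the
   expected one is passed as a separate index with a proof of the equation,
   instead of being transported along it. *)
Record complex (k : comPzRingType) := Complex {
  cterm :> int -> lmodType k;
  cd : forall i j : int, j = i + 1 -> cterm i -> cterm j;
  cd_linear : forall i j (e : j = i + 1), linear (@cd i j e);
  cd_cd : forall i j l (e : j = i + 1) (e' : l = j + 1) (x : cterm i),
    cd e' (cd e x) = 0
}.

Record chmap (k : comPzRingType) (M N : complex k) := ChMap {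
  chfun :> forall i, M i -> N i;
  chfun_linear : forall i, linear (@chfun i);
  chfun_cd : forall i j (e : j = i + 1) (x : M i),
    chfun (cd e x) = cd e (chfun x)
}.

Section ComplexTheory.
Variables (k : comPzRingType) (M : complex k).

Lemma cdD i j (e : j = i + 1) (x y : M i) : cd e (x + y) = cd e x + cd e y.
Proof. by have := cd_linear e 1 x y; rewrite !scale1r. Qed.

Lemma cdZ i j (e : j = i + 1) a (x : M i) : cd e (a *: x) = a *: cd e x.
Proof.
have cd0 : cd e (0 : M i) = 0.
  by have := cdD e 0 0; rewrite addr0 -{1}[cd e 0]addr0 => /addrI.
by have := cd_linear e a x 0; rewrite cd0 !addr0.
Qed.

Lemma cdN i j (e : j = i + 1) (x : M i) : cd e (- x) = - cd e x.
Proof. by rewrite -scaleN1r cdZ scaleN1r. Qed.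

Lemma cdB i j (e : j = i + 1) (x y : M i) : cd e (x - y) = cd e x - cd e y.
Proof. by rewrite cdD cdN. Qed.

Lemma cd0 i j (e : j = i + 1) : cd e (0 : M i) = 0.
Proof. by rewrite -(scale0r (0 : M i)) cdZ scale0r. Qed.

Variable i : int.

Definition is_cocycle : {pred M i} := fun x => cd (erefl (i + 1)) x == 0.

Fact is_cocycle_closed : zmod_closed is_cocycle.
Proof.
split; first by rewrite unfold_in cd0.
by move=> x y; rewrite !unfold_in => /eqP ex /eqP ey; rewrite cdB ex ey subrr.
Qed.
HB.instance Definition _ :=
  GRing.isZmodClosed.Build (M i) is_cocycle is_cocycle_closed.

Record cocycle := Cocycle { cocval :> M i; cocvalP : cocval \in is_cocycle }.
HB.instance Definition _ := [isSub for cocval].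
HB.instance Definition _ := [Choice of cocycle by <:].
HB.instance Definition _ := [SubChoice_isSubZmodule of cocycle by <:].

Definition is_coboundary : {pred cocycle} :=
  fun z => `[< exists x : M (i - 1), cd (esym (subrK 1 i)) x = val z >].

Fact is_coboundary_closed : zmod_closed is_coboundary.
Proof.
split; first by apply/asboolP; exists 0; rewrite cd0 raddf0.
move=> y z /asboolP[u eu] /asboolP[v ev].
by apply/asboolP; exists (u - v); rewrite cdB eu ev raddfB.
Qed.
HB.instance Definition _ :=
  GRing.isZmodClosed.Build cocycle is_coboundary is_coboundary_closed.

(* Only the additive structure of H^i is recorded: the maps below are induced
   by k-linear chain maps, so bijective on classes means k-linear isomorphism. *)
Definition cohom := Quotient.quot (is_coboundary : zmodClosed cocycle).
HB.instance Definition _ := GRing.Zmodule.on cohom.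

Definition cls (z : cocycle) : cohom :=
  \pi_(Quotient.quot (is_coboundary : zmodClosed cocycle)) z.
Definition crepr (c : cohom) : cocycle :=
  repr (c : Quotient.quot (is_coboundary : zmodClosed cocycle)).

Lemma creprK c : cls (crepr c) = c.
Proof. exact: reprK. Qed.

Lemma clsD y z : cls (y + z) = cls y + cls z.
Proof. exact: (raddfD \pi_(Quotient.quot (is_coboundary : zmodClosed cocycle))). Qed.

Lemma cls_eqP (y z : cocycle) :
  (cls y = cls z) <->
  exists x : M (i - 1), cd (esym (subrK 1 i)) x = cocval y - cocval z.
Proof.
have -> : cocval y - cocval z = val (y - z) by rewrite raddfB.
split.
  by move/eqP; rewrite -Quotient.idealrBE => /asboolP.
by move=> h; apply/eqP; rewrite -Quotient.idealrBE; apply/asboolP.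
Qed.

End ComplexTheory.

Arguments is_cocycle {k M i}.
Arguments cls {k M i}.
Arguments crepr {k M i}.
Arguments Cocycle {k M i}.

Lemma cdK0 (k : comPzRingType) (M : complex k) i (z : cocycle M i) j
  (e : j = i + 1) : cd e (cocval z) = 0.
Proof. by subst j; apply/eqP; apply: (cocvalP z). Qed.

Lemma cocycleP (k : comPzRingType) (M : complex k) i j (e : j = i + 1) (x : M i) :
  cd e x = 0 -> x \in is_cocycle.
Proof. by subst j => ex; apply/eqP. Qed.

Section CohomMap.
Variables (k : comPzRingType) (M N : complex k) (phi : chmap M N) (i : int).

Lemma chfunB (x y : M i) : phi i (x - y) = phi i x - phi i y.
Proof.
have -> : x - y = -1 *: y + x by rewrite scaleN1r addrC.
by rewrite chfun_linear scaleN1r addrC.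
Qed.

Lemma chfun0 j : phi j (0 : M j) = 0.
Proof.
have := chfun_linear phi (-1) (0 : M j) 0.
by rewrite scaler0 addr0 scaleN1r addNr.
Qed.

Fact cocycle_map_subproof (z : cocycle M i) : phi i z \in is_cocycle.
Proof.
apply: (cocycleP (e := erefl)); rewrite -chfun_cd cdK0.
by rewrite chfun0.
Qed.

Definition cocycle_map (z : cocycle M i) : cocycle N i :=
  Cocycle (phi i z) (cocycle_map_subproof z).

(* Independent of the chosen representatives by cohom_map_cls. *)
Definition cohom_map (c : cohom M i) : cohom N i := cls (cocycle_map (crepr c)).

Lemma cohom_map_cls z : cohom_map (cls z) = cls (cocycle_map z).
Proof.
have /cls_eqP[x ex] := creprK (cls z).
by apply/cls_eqP; exists (phi _ x); rewrite -chfun_cd ex chfunB.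
Qed.

End CohomMap.

Definition castdeg (k : comPzRingType) (M : complex k) (i j : int) (e : i = j) :
  M i -> M j := fun x => match e in _ = n return M n with erefl => x end.

Lemma cd_castdeg (k : comPzRingType) (M : complex k) i i' j j' (e : i = i')
    (f : j = j') (a : j = i + 1) (b : j' = i' + 1) (x : M i) :
  cd b (castdeg e x) = castdeg f (cd a x).
Proof. by subst i' j'; rewrite (eq_irrelevance a b). Qed.

Lemma castdeg_linear (k : comPzRingType) (M : complex k) i j (e : i = j) :
  linear (@castdeg k M i j e).
Proof. by subst j. Qed.

Section Fib.
Variables (k : comPzRingType) (M N : complex k) (phi : chmap M N).

Definition fib_term (i : int) : lmodType k := (M i * N (i - 1))%type.

Fact fib_eq1 (i j : int) : j = i + 1 -> i = j - 1.
Proof. by move->; rewrite addrK. Qed.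
Fact fib_eq2 (i j : int) : j = i + 1 -> j - 1 = i - 1 + 1.
Proof. by move->; rewrite addrK subrK. Qed.

Definition fib_d (i j : int) (e : j = i + 1) (x : fib_term i) : fib_term j :=
  (cd e x.1, - castdeg (fib_eq1 e) (phi i x.1) - cd (fib_eq2 e) x.2).

Fact fib_d_linear i j (e : j = i + 1) : linear (@fib_d i j e).
Proof.
move=> a [x y] [x' y']; apply: injective_projections => /=.
  exact: cd_linear.
rewrite cd_linear chfun_linear.
rewrite castdeg_linear scalerBr scalerN !opprD !addrA; congr (_ + _).
by rewrite addrAC.
Qed.

Fact fib_d_d i j l (e : j = i + 1) (e' : l = j + 1) (x : fib_term i) :
  fib_d e' (fib_d e x) = 0.
Proof.
case: x => x y; apply: injective_projections => /=; first exact: cd_cd.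
rewrite cdB cdN cd_cd subr0 opprK chfun_cd.
by rewrite (cd_castdeg _ (fib_eq1 e') e) addNr.
Qed.

Definition Fib : complex k := Complex fib_d_linear fib_d_d.

End Fib.

Record dgcat (k : comPzRingType) := DGCat {
  dgob :> Type;
  dghom : dgob -> dgob -> complex k;
  dgid : forall X, dghom X X 0;
  dgcomp : forall X Y Z i j n, n = i + j ->
    dghom Y Z i -> dghom X Y j -> dghom X Z n;
  dgcomp_linearl : forall X Y Z i j n (e : n = i + j) (f : dghom X Y j),
    linear (fun g : dghom Y Z i => dgcomp e g f);
  dgcomp_linearr : forall X Y Z i j n (e : n = i + j) (g : dghom Y Z i),
    linear (fun f : dghom X Y j => dgcomp e g f);
  dgcomp_idl : forall X Y j (e : j = 0 + j) (f : dghom X Y j),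
    dgcomp e (dgid Y) f = f;
  dgcomp_idr : forall X Y j (e : j = j + 0) (f : dghom X Y j),
    dgcomp e f (dgid X) = f;
  dgcomp_assoc : forall X Y Z W i j l ij jl n
    (e1 : jl = j + l) (e2 : n = i + jl) (e3 : ij = i + j) (e4 : n = ij + l)
    (h : dghom Z W i) (g : dghom Y Z j) (f : dghom X Y l),
    dgcomp e2 h (dgcomp e1 g f) = dgcomp e4 (dgcomp e3 h g) f;
  dg_leibniz : forall X Y Z i j n i' j' n' (e : n = i + j) (en : n' = n + 1)
    (ei : i' = i + 1) (e1 : n' = i' + j) (ej : j' = j + 1) (e2 : n' = i + j')
    (g : dghom Y Z i) (f : dghom X Y j),
    cd en (dgcomp e g f)
      = dgcomp e1 (cd ei g) f + (-1) ^+ `|i|%N *: dgcomp e2 g (cd ej f);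
  dg_nonpositive : forall X Y i (f : dghom X Y i), 0 < i -> f = 0
}.

Definition truncated2 (k : comPzRingType) (A : dgcat k) : Prop :=
  forall (X Y : A) (i : int), i <= -2 -> forall c : cohom (dghom X Y) i, c = 0.

Definition strict_truncated2 (k : comPzRingType) (A : dgcat k) : Prop :=
  forall (X Y : A) (i : int), i <= -2 -> forall f : dghom X Y i, f = 0.

(* Closed morphisms of degree 0.  By non-positivity every morphism of degree 0
   is closed. *)
Notation zmor X Y := (cocycle (dghom X Y) 0).

Section DGTheory.
Variables (k : comPzRingType) (A : dgcat k).
Implicit Types X Y Z W : A.

Section Comp.
Variables (X Y Z : A) (i j n : int) (e : n = i + j).
Implicit Types (g : dghom Y Z i) (f : dghom X Y j).

Lemma dgcompDl g g' f : dgcomp e (g + g') f = dgcomp e g f + dgcomp e g' f.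
Proof. by have := dgcomp_linearl e f 1 g g'; rewrite !scale1r. Qed.

Lemma dgcompDr g f f' : dgcomp e g (f + f') = dgcomp e g f + dgcomp e g f'.
Proof. by have := dgcomp_linearr e g 1 f f'; rewrite !scale1r. Qed.

Lemma dgcomp0l f : dgcomp e (0 : dghom Y Z i) f = 0.
Proof.
have := dgcompDl 0 0 f; rewrite addr0 -{1}[dgcomp e 0 f]addr0.
by move=> /addrI.
Qed.

Lemma dgcomp0r g : dgcomp e g (0 : dghom X Y j) = 0.
Proof.
have := dgcompDr g 0 0; rewrite addr0 -{1}[dgcomp e g 0]addr0.
by move=> /addrI.
Qed.

Lemma dgcompZl a g f : dgcomp e (a *: g) f = a *: dgcomp e g f.
Proof. by have := dgcomp_linearl e f a g 0; rewrite !addr0 dgcomp0l addr0. Qed.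

Lemma dgcompZr a g f : dgcomp e g (a *: f) = a *: dgcomp e g f.
Proof. by have := dgcomp_linearr e g a f 0; rewrite !addr0 dgcomp0r addr0. Qed.

Lemma dgcompNl g f : dgcomp e (- g) f = - dgcomp e g f.
Proof. by rewrite -scaleN1r dgcompZl scaleN1r. Qed.

Lemma dgcompNr g f : dgcomp e g (- f) = - dgcomp e g f.
Proof. by rewrite -scaleN1r dgcompZr scaleN1r. Qed.

Lemma dgcompBl g g' f : dgcomp e (g - g') f = dgcomp e g f - dgcomp e g' f.
Proof. by rewrite dgcompDl dgcompNl. Qed.

Lemma dgcompBr g f f' : dgcomp e g (f - f') = dgcomp e g f - dgcomp e g f'.
Proof. by rewrite dgcompDr dgcompNr. Qed.

End Comp.

Lemma castdeg_dgcomp X Y Z i j n m (e : n = m) (a : n = i + j) (b : m = i + j)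
    (g : dghom Y Z i) (f : dghom X Y j) :
  castdeg e (dgcomp a g f) = dgcomp b g f.
Proof. by subst m; rewrite (eq_irrelevance a b). Qed.

Lemma sign_succ i j : j = i + 1 -> (-1) ^+ `|j|%N = - (-1) ^+ `|i|%N :> k.
Proof.
move=> ->; case: i => n; first by rewrite addrC -intS exprS mulN1r.
have -> : Negz n + 1 = - n%:Z by rewrite NegzE -addn1 PoszD opprD subrK.
by rewrite abszN exprS mulN1r opprK.
Qed.

Fact zmor_comp_subproof X Y Z (g : zmor Y Z) (f : zmor X Y) :
  dgcomp (erefl : 0 = 0 + 0 :> int) g f \in is_cocycle.
Proof.
apply: (cocycleP (e := erefl)).
rewrite (dg_leibniz _ (erefl : 1 = 0 + 1 :> int) (erefl : 1 = 0 + 1 :> int)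
  (erefl : 1 = 1 + 0 :> int) (erefl : 1 = 0 + 1 :> int) (erefl : 1 = 0 + 1 :> int)).
by rewrite !cdK0 dgcomp0l dgcomp0r scaler0 addr0.
Qed.

Definition zmor_comp X Y Z (g : zmor Y Z) (f : zmor X Y) : zmor X Z :=
  Cocycle _ (zmor_comp_subproof g f).

Fact zmor_id_subproof X : dgid X \in is_cocycle.
Proof. by apply: (cocycleP (e := erefl)); apply: dg_nonpositive. Qed.

Definition zmor_id X : zmor X X := Cocycle _ (zmor_id_subproof X).

Section Whisker.
Variables (X Y : A) (f : zmor X Y) (W : A).

Fact postcomp_linear i :
  linear (fun u : dghom W X i => dgcomp (esym (add0r i)) (cocval f) u).
Proof. exact: dgcomp_linearr. Qed.

Fact postcomp_cd i j (e : j = i + 1) (u : dghom W X i) :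
  dgcomp (esym (add0r j)) (cocval f) (cd e u) =
  cd e (dgcomp (esym (add0r i)) (cocval f) u).
Proof.
have e1 : j = 1 + i by rewrite addrC.
rewrite (dg_leibniz _ e (erefl : 1 = 0 + 1 :> int) e1 e (esym (add0r j))).
by rewrite cdK0 dgcomp0l [_ ^+ _]expr0 scale1r [RHS]add0r.
Qed.

Definition postcomp : chmap (dghom W X) (dghom W Y) :=
  ChMap postcomp_linear postcomp_cd.

Fact precomp_linear i :
  linear (fun u : dghom Y W i => dgcomp (esym (addr0 i)) u (cocval f)).
Proof. exact: dgcomp_linearl. Qed.

Fact precomp_cd i j (e : j = i + 1) (u : dghom Y W i) :
  dgcomp (esym (addr0 j)) (cd e u) (cocval f) =
  cd e (dgcomp (esym (addr0 i)) u (cocval f)).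
Proof.
rewrite (dg_leibniz _ e e (esym (addr0 j)) (erefl : 1 = 0 + 1 :> int) e).
by rewrite cdK0 dgcomp0r scaler0 [RHS]addr0.
Qed.

Definition precomp : chmap (dghom Y W) (dghom X W) :=
  ChMap precomp_linear precomp_cd.

End Whisker.

Record three_term X Y Z := ThreeTerm {
  tt_f : zmor X Y;
  tt_g : zmor Y Z;
  tt_h : dghom X Z (-1);
  tt_d : cd (erefl : 0 = -1 + 1 :> int) tt_h
         = - dgcomp (erefl : 0 = 0 + 0 :> int) (cocval tt_g) (cocval tt_f)
}.

Section ThreeTermMaps.
Variables (X Y Z : A) (t : three_term X Y Z) (W : A).
Local Notation f := (cocval (tt_f t)).
Local Notation g := (cocval (tt_g t)).
Local Notation h := (tt_h t).

Definition left_fun i (u : dghom W X i) : Fib (postcomp (tt_g t) W) i :=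
  (dgcomp (esym (add0r i)) f u, dgcomp (addrC i (-1)) h u).

Fact left_fun_linear i : linear (@left_fun i).
Proof.
by move=> a u v; apply: injective_projections => /=; rewrite dgcompDr dgcompZr.
Qed.

Fact left_fun_cd i j (e : j = i + 1) (u : dghom W X i) :
  left_fun (cd e u) = cd e (left_fun u).
Proof.
apply: injective_projections; first exact: (postcomp_cd (tt_f t) e u).
have e1 : j - 1 = 0 + i by rewrite e addrK add0r.
have e2 : j - 1 = -1 + j by rewrite addrC.
rewrite /= (dg_leibniz _ (fib_eq2 e) (erefl : 0 = -1 + 1 :> int) e1 e e2).
rewrite tt_d dgcompNl [_ ^+ _]expr1 scaleN1r opprB opprK.
rewrite (dgcomp_assoc (esym (add0r i)) (esym (add0r i)) (erefl : 0 = 0 + 0 :> int)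
  (esym (add0r i))).
rewrite (castdeg_dgcomp _ _ e1) addrCA addNr addr0.
by rewrite (eq_irrelevance (addrC j (-1)) e2).
Qed.

Definition left_map : chmap (dghom W X) (Fib (postcomp (tt_g t) W)) :=
  ChMap left_fun_linear left_fun_cd.

Definition right_fun i (u : dghom Z W i) : Fib (precomp (tt_f t) W) i :=
  (dgcomp (esym (addr0 i)) u g,
   (-1) ^+ `|i|%N *: dgcomp (erefl : i - 1 = i + -1 :> int) u h).

Fact right_fun_linear i : linear (@right_fun i).
Proof.
move=> a u v; apply: injective_projections => /=; rewrite dgcompDl dgcompZl //.
by rewrite scalerDr !scalerA mulrC.
Qed.

Fact right_fun_cd i j (e : j = i + 1) (u : dghom Z W i) :
  right_fun (cd e u) = cd e (right_fun u).
Proof.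
apply: injective_projections; first exact: (precomp_cd (tt_g t) e u).
have e1 : j - 1 = j + -1 by [].
have e2 : j - 1 = i + 0 by rewrite e addrK addr0.
rewrite /= cdZ (dg_leibniz _ (fib_eq2 e) e e1 (erefl : 0 = -1 + 1 :> int) e2).
rewrite tt_d dgcompNr.
rewrite (dgcomp_assoc (erefl : 0 = 0 + 0 :> int) e2 (esym (addr0 i)) e2).
rewrite (castdeg_dgcomp _ _ e2) scalerN scalerBr scalerA -expr2 sqrr_sign scale1r.
rewrite opprB addrA addNr add0r.
by rewrite (sign_succ e) scaleNr (eq_irrelevance (erefl : j - 1 = j + -1) e1).
Qed.

Definition right_map : chmap (dghom Z W) (Fib (precomp (tt_f t) W)) :=
  ChMap right_fun_linear right_fun_cd.

End ThreeTermMaps.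

Definition left_exact X Y Z (t : three_term X Y Z) : Prop :=
  forall W (i : int), i <= 0 -> bijective (cohom_map (left_map t W) (i := i)).

Definition right_exact X Y Z (t : three_term X Y Z) : Prop :=
  forall W (i : int), i <= 0 -> bijective (cohom_map (right_map t W) (i := i)).

Definition short_exact X Y Z (t : three_term X Y Z) : Prop :=
  left_exact t /\ right_exact t.

Definition has_homotopy_kernel Y Z (g : zmor Y Z) : Prop :=
  exists (X : A) (t : three_term X Y Z), tt_g t = g /\ left_exact t.

Definition has_homotopy_cokernel X Y (f : zmor X Y) : Prop :=
  exists (Z : A) (t : three_term X Y Z), tt_f t = f /\ right_exact t.

Definition mono2 X Y (f : zmor X Y) : Prop := forall W,
  injective (cohom_map (postcomp f W) (i := -1)) /\
  forall i : int, i <= -2 -> bijective (cohom_map (postcomp f W) (i := i)).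

(* The condition [mono2] for f in the opposite DG-category, where the
   composite of f and u is (-1)^(|u||f|) u f = u f since |f| = 0. *)
Definition epi2 X Y (f : zmor X Y) : Prop := forall W,
  injective (cohom_map (precomp f W) (i := -1)) /\
  forall i : int, i <= -2 -> bijective (cohom_map (precomp f W) (i := i)).

End DGTheory.

Record preadditive := Preadditive {
  paob :> Type;
  pahom : paob -> paob -> zmodType;
  paid : forall X, pahom X X;
  pacomp : forall X Y Z, pahom Y Z -> pahom X Y -> pahom X Z;
  pacomp_assoc : forall X Y Z W (h : pahom Z W) (g : pahom Y Z) (f : pahom X Y),
    pacomp h (pacomp g f) = pacomp (pacomp h g) f;
  pacomp_idl : forall X Y (f : pahom X Y), pacomp (paid Y) f = f;
  pacomp_idr : forall X Y (f : pahom X Y), pacomp f (paid X) = f;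
  pacompDl : forall X Y Z (g g' : pahom Y Z) (f : pahom X Y),
    pacomp (g + g') f = pacomp g f + pacomp g' f;
  pacompDr : forall X Y Z (g : pahom Y Z) (f f' : pahom X Y),
    pacomp g (f + f') = pacomp g f + pacomp g f'
}.

Section Additive.
Variable C : preadditive.

Definition is_zero_object (Z : C) : Prop :=
  (forall X (f : pahom X Z), f = 0) /\ (forall X (f : pahom Z X), f = 0).

Definition is_biproduct (X Y P : C) (i1 : pahom X P) (i2 : pahom Y P)
    (p1 : pahom P X) (p2 : pahom P Y) : Prop :=
  [/\ pacomp p1 i1 = paid X, pacomp p2 i2 = paid Y,
      pacomp p2 i1 = 0, pacomp p1 i2 = 0 &
      pacomp i1 p1 + pacomp i2 p2 = paid P].

Definition is_additive : Prop :=
  (exists Z : C, is_zero_object Z) /\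
  forall X Y : C, exists (P : C) (i1 : pahom X P) (i2 : pahom Y P)
    (p1 : pahom P X) (p2 : pahom P Y), is_biproduct i1 i2 p1 p2.

End Additive.

Section HomotopyCategory.
Variables (k : comPzRingType) (A : dgcat k).
Implicit Types X Y Z W : A.

Definition H0hom X Y : zmodType := cohom (dghom X Y) 0.
Definition H0id X : H0hom X X := cls (zmor_id X).
(* Independent of the chosen representatives by H0comp_cls. *)
Definition H0comp X Y Z (g : H0hom Y Z) (f : H0hom X Y) : H0hom X Z :=
  cls (zmor_comp (crepr g) (crepr f)).

Lemma H0comp_cls X Y Z (g : zmor Y Z) (f : zmor X Y) :
  H0comp (cls g) (cls f) = cls (zmor_comp g f).
Proof.
have /cls_eqP[u eu] := creprK (cls g); have /cls_eqP[v ev] := creprK (cls f).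
apply/cls_eqP.
set g' := crepr _ in eu *; set f' := crepr _ in ev *.
exists (dgcomp (erefl : -1 = -1 + 0 :> int) u (cocval f')
        + dgcomp (erefl : -1 = 0 + -1 :> int) (cocval g) v).
rewrite cdD.
rewrite (dg_leibniz _ (esym (subrK 1 0)) (esym (subrK 1 0))
  (erefl : 0 = 0 + 0 :> int) (erefl : 1 = 0 + 1 :> int)
  (erefl : 0 = -1 + 1 :> int)).
rewrite (dg_leibniz _ (esym (subrK 1 0)) (erefl : 1 = 0 + 1 :> int)
  (erefl : 0 = 1 + -1 :> int) (esym (subrK 1 0))
  (erefl : 0 = 0 + 0 :> int)).
rewrite eu ev !cdK0 dgcomp0r dgcomp0l scaler0 addr0 [_ ^+ _]expr0 scale1r add0r.
by rewrite dgcompBl dgcompBr addrA subrK.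
Qed.

Fact H0comp_assoc X Y Z W (h : H0hom Z W) (g : H0hom Y Z) (f : H0hom X Y) :
  H0comp h (H0comp g f) = H0comp (H0comp h g) f.
Proof.
rewrite -[h]creprK -[g]creprK -[f]creprK !H0comp_cls; congr cls.
by apply: val_inj; apply: dgcomp_assoc.
Qed.

Fact H0comp_idl X Y (f : H0hom X Y) : H0comp (H0id Y) f = f.
Proof.
rewrite -[f]creprK H0comp_cls; congr cls.
by apply: val_inj; apply: dgcomp_idl.
Qed.

Fact H0comp_idr X Y (f : H0hom X Y) : H0comp f (H0id X) = f.
Proof.
rewrite -[f]creprK H0comp_cls; congr cls.
by apply: val_inj; apply: dgcomp_idr.
Qed.

Fact H0compDl X Y Z (g g' : H0hom Y Z) (f : H0hom X Y) :
  H0comp (g + g') f = H0comp g f + H0comp g' f.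
Proof.
rewrite -[g]creprK -[g']creprK -[f]creprK -clsD !H0comp_cls -clsD; congr cls.
by apply: val_inj; apply: dgcompDl.
Qed.

Fact H0compDr X Y Z (g : H0hom Y Z) (f f' : H0hom X Y) :
  H0comp g (f + f') = H0comp g f + H0comp g f'.
Proof.
rewrite -[g]creprK -[f']creprK -[f]creprK -clsD !H0comp_cls -clsD; congr cls.
by apply: val_inj; apply: dgcompDr.
Qed.

Definition H0cat : preadditive :=
  Preadditive H0comp_assoc H0comp_idl H0comp_idr H0compDl H0compDr.

End HomotopyCategory.

Record abelian_truncated2 (k : comPzRingType) (A : dgcat k) : Prop := {
  ab_truncated : truncated2 A;
  ab_additive : is_additive (H0cat A);
  ab_kernel : forall (X Y : A) (f : zmor X Y), has_homotopy_kernel f;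
  ab_cokernel : forall (X Y : A) (f : zmor X Y), has_homotopy_cokernel f;
  ab_mono : forall (X Y Z : A) (t : three_term X Y Z),
    right_exact t -> mono2 (tt_f t) -> short_exact t;
  ab_epi : forall (X Y Z : A) (t : three_term X Y Z),
    left_exact t -> epi2 (tt_g t) -> short_exact t
}.

Record category := Category {
  cobj :> Type;
  chom : cobj -> cobj -> Type;
  cid : forall a, chom a a;
  ccomp : forall a b c, chom b c -> chom a b -> chom a c;
  ccomp_assoc : forall a b c d (h : chom c d) (g : chom b c) (f : chom a b),
    ccomp h (ccomp g f) = ccomp (ccomp h g) f;
  ccomp_idl : forall a b (f : chom a b), ccomp (cid b) f = f;
  ccomp_idr : forall a b (f : chom a b), ccomp f (cid a) = f
}.

Declare Scope cell_scope.
Delimit Scope cell_scope with cell.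
Local Open Scope cell_scope.
Notation "g \v f" := (ccomp g f) (at level 40, left associativity) : cell_scope.

Definition eq_cell (C : category) (a b : C) (e : a = b) : chom a b :=
  match e in _ = c return chom a c with erefl => cid a end.

Record functor (C D : category) := Functor {
  fobj :> C -> D;
  fmap : forall a b, chom a b -> chom (fobj a) (fobj b);
  fmap_id : forall a, fmap (cid a) = cid (fobj a);
  fmap_comp : forall a b c (g : chom b c) (f : chom a b),
    fmap (g \v f) = fmap g \v fmap f
}.

(* Since every morphism is invertible, the invertibility of the structural
   morphisms below need not be required separately. *)
Record scg (C : category) := SCG {
  tens : C -> C -> C;
  tensm : forall a a' b b', chom a a' -> chom b b' -> chom (tens a b) (tens a' b');
  tensm_id : forall a b, tensm (cid a) (cid b) = cid (tens a b);
  tensm_comp : forall a a' a'' b b' b'' (f' : chom a' a'') (f : chom a a')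
    (g' : chom b' b'') (g : chom b b'),
    tensm (f' \v f) (g' \v g) = tensm f' g' \v tensm f g;
  tunit : C;
  tassoc : forall a b c, chom (tens (tens a b) c) (tens a (tens b c));
  tlunit : forall a, chom (tens tunit a) a;
  trunit : forall a, chom (tens a tunit) a;
  tsym : forall a b, chom (tens a b) (tens b a);
  tassoc_nat : forall a a' b b' c c' (f : chom a a') (g : chom b b') (h : chom c c'),
    tassoc a' b' c' \v tensm (tensm f g) h = tensm f (tensm g h) \v tassoc a b c;
  tlunit_nat : forall a a' (f : chom a a'),
    tlunit a' \v tensm (cid tunit) f = f \v tlunit a;
  trunit_nat : forall a a' (f : chom a a'),
    trunit a' \v tensm f (cid tunit) = f \v trunit a;
  tsym_nat : forall a a' b b' (f : chom a a') (g : chom b b'),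
    tsym a' b' \v tensm f g = tensm g f \v tsym a b;
  tpentagon : forall a b c d,
    tassoc a b (tens c d) \v tassoc (tens a b) c d
    = tensm (cid a) (tassoc b c d) \v tassoc a (tens b c) d
        \v tensm (tassoc a b c) (cid d);
  ttriangle : forall a b,
    tensm (cid a) (tlunit b) \v tassoc a tunit b = tensm (trunit a) (cid b);
  thexagon : forall a b c,
    tassoc b c a \v tsym a (tens b c) \v tassoc a b c
    = tensm (cid b) (tsym a c) \v tassoc b a c \v tensm (tsym a b) (cid c);
  tsym_sym : forall a b : C, tsym b a \v tsym a b = cid (tens a b);
  scg_inv_hom : forall (a b : C) (f : chom a b),
    exists g : chom b a, g \v f = cid a /\ f \v g = cid b;
  scg_inv_obj : forall a : C, exists b : C, inhabited (chom (tens a b) tunit)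
}.

Record monoidal (C D : category) (sC : scg C) (sD : scg D) (F : functor C D) :=
  Monoidal {
  mtens : forall a b, chom (F (tens sC a b)) (tens sD (F a) (F b));
  munit : chom (F (tunit sC)) (tunit sD);
  mtens_nat : forall a a' b b' (f : chom a a') (g : chom b b'),
    mtens a' b' \v fmap F (tensm sC f g)
    = tensm sD (fmap F f) (fmap F g) \v mtens a b;
  mtens_assoc : forall a b c,
    tassoc sD (F a) (F b) (F c) \v tensm sD (mtens a b) (cid (F c))
        \v mtens (tens sC a b) c
    = tensm sD (cid (F a)) (mtens b c) \v mtens a (tens sC b c)
        \v fmap F (tassoc sC a b c);
  munit_l : forall a,
    tlunit sD (F a) \v tensm sD munit (cid (F a)) \v mtens (tunit sC) a
    = fmap F (tlunit sC a);
  munit_r : forall a,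
    trunit sD (F a) \v tensm sD (cid (F a)) munit \v mtens a (tunit sC)
    = fmap F (trunit sC a)
}.

(* Strict 2-categories with invertible 2-cells.  Composition of 1-cells is
   associative and unital on the nose; since the 2-cells on the two sides of
   these equations have different types, the corresponding laws for horizontal
   composition of 2-cells are stated up to the identity 2-cells [eq_cell]. *)
Record cat21 := Cat21 {
  ob21 :> Type;
  hom21 : ob21 -> ob21 -> category;
  id21 : forall X, hom21 X X;
  comp21 : forall X Y Z, hom21 Y Z -> hom21 X Y -> hom21 X Z;
  hcomp : forall X Y Z (g g' : hom21 Y Z) (f f' : hom21 X Y),
    chom g g' -> chom f f' -> chom (comp21 g f) (comp21 g' f');
  hcomp_id : forall X Y Z (g : hom21 Y Z) (f : hom21 X Y),
    hcomp (cid g) (cid f) = cid (comp21 g f);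
  interchange : forall X Y Z (g g' g'' : hom21 Y Z) (f f' f'' : hom21 X Y)
    (q' : chom g' g'') (q : chom g g') (p' : chom f' f'') (p : chom f f'),
    hcomp (q' \v q) (p' \v p) = hcomp q' p' \v hcomp q p;
  assoc21 : forall X Y Z W (h : hom21 Z W) (g : hom21 Y Z) (f : hom21 X Y),
    comp21 h (comp21 g f) = comp21 (comp21 h g) f;
  idl21 : forall X Y (f : hom21 X Y), comp21 (id21 Y) f = f;
  idr21 : forall X Y (f : hom21 X Y), comp21 f (id21 X) = f;
  hcomp_assoc : forall X Y Z W (h h' : hom21 Z W) (g g' : hom21 Y Z)
    (f f' : hom21 X Y) (r : chom h h') (q : chom g g') (p : chom f f'),
    eq_cell (assoc21 h' g' f') \v hcomp r (hcomp q p)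
    = hcomp (hcomp r q) p \v eq_cell (assoc21 h g f);
  hcomp_idl : forall X Y (f f' : hom21 X Y) (p : chom f f'),
    eq_cell (idl21 f') \v hcomp (cid (id21 Y)) p = p \v eq_cell (idl21 f);
  hcomp_idr : forall X Y (f f' : hom21 X Y) (p : chom f f'),
    eq_cell (idr21 f') \v hcomp p (cid (id21 X)) = p \v eq_cell (idr21 f);
  inv21 : forall X Y (f g : hom21 X Y) (p : chom f g),
    exists q : chom g f, q \v p = cid f /\ p \v q = cid g
}.

Notation "g \o1 f" := (comp21 g f) (at level 40, left associativity) : cell_scope.
Notation "f \wl p" := (hcomp (cid f) p) (at level 40, left associativity) : cell_scope.
Notation "p \wr f" := (hcomp p (cid f)) (at level 40, left associativity) : cell_scope.

Section HomFunctors.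
Variables (S : cat21) (X Y : S) (f : hom21 X Y) (Z : S).

Fact post21_comp (a b c : hom21 Z X) (q : chom b c) (p : chom a b) :
  f \wl (q \v p) = (f \wl q) \v (f \wl p).
Proof. by rewrite -interchange ccomp_idl. Qed.

Definition post21 : functor (hom21 Z X) (hom21 Z Y) :=
  @Functor (hom21 Z X) (hom21 Z Y) (fun a => f \o1 a) (fun a b p => f \wl p)
    (fun a => hcomp_id f a) post21_comp.

Fact pre21_comp (a b c : hom21 Y Z) (q : chom b c) (p : chom a b) :
  (q \v p) \wr f = (q \wr f) \v (p \wr f).
Proof. by rewrite -interchange ccomp_idl. Qed.

Definition pre21 : functor (hom21 Y Z) (hom21 X Z) :=
  @Functor (hom21 Y Z) (hom21 X Z) (fun a => a \o1 f) (fun a b p => p \wr f)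
    (fun a => hcomp_id a f) pre21_comp.

End HomFunctors.

Record pre_scg_cat := PreSCGCat {
  pcat :> cat21;
  pscg : forall X Y : pcat, scg (hom21 X Y);
  pzero_comp : forall X Y Z : pcat,
    tunit (pscg Y Z) \o1 tunit (pscg X Y) = tunit (pscg X Z);
  ppost : forall (X Y : pcat) (f : hom21 X Y) (Z : pcat),
    monoidal (pscg Z X) (pscg Z Y) (post21 f Z);
  ppre : forall (X Y : pcat) (f : hom21 X Y) (Z : pcat),
    monoidal (pscg Y Z) (pscg X Z) (pre21 f Z);
  ppost_zero : forall X Y Z : pcat,
    munit (ppost (tunit (pscg X Y)) Z) = eq_cell (pzero_comp Z X Y);
  ppre_zero : forall X Y Z : pcat,
    munit (ppre (tunit (pscg X Y)) Z) = eq_cell (pzero_comp X Y Z)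
}.

Section RelativelyExact.
Variable S : pre_scg_cat.
Implicit Types X Y Z A B C K P : S.

Definition zero1 X Y : hom21 X Y := tunit (pscg X Y).

Definition comp_zero X Y (f : hom21 X Y) Z : chom (f \o1 zero1 Z X) (zero1 Z Y) :=
  munit (ppost f Z).
Definition zero_comp X Y (f : hom21 X Y) Z : chom (zero1 Y Z \o1 f) (zero1 X Z) :=
  munit (ppre f Z).

Definition zero_object21 Z : Prop := forall X,
  (forall f : hom21 X Z, exists! p : chom f (zero1 X Z), True) /\
  (forall g : hom21 Z X, exists! p : chom g (zero1 Z X), True).

Definition is_product21 A1 A2 P (p1 : hom21 P A1) (p2 : hom21 P A2) : Prop :=
  forall X (q1 : hom21 X A1) (q2 : hom21 X A2),
  (exists q : hom21 X P,
     inhabited (chom (p1 \o1 q) q1) /\ inhabited (chom (p2 \o1 q) q2)) /\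
  (forall (q q' : hom21 X P)
     (xi1 : chom (p1 \o1 q) q1) (xi2 : chom (p2 \o1 q) q2)
     (xi1' : chom (p1 \o1 q') q1) (xi2' : chom (p2 \o1 q') q2),
     exists! eta : chom q q',
       xi1' \v (p1 \wl eta) = xi1 /\ xi2' \v (p2 \wl eta) = xi2).

Definition is_coproduct21 A1 A2 P (i1 : hom21 A1 P) (i2 : hom21 A2 P) : Prop :=
  forall X (q1 : hom21 A1 X) (q2 : hom21 A2 X),
  (exists q : hom21 P X,
     inhabited (chom (q \o1 i1) q1) /\ inhabited (chom (q \o1 i2) q2)) /\
  (forall (q q' : hom21 P X)
     (xi1 : chom (q \o1 i1) q1) (xi2 : chom (q \o1 i2) q2)
     (xi1' : chom (q' \o1 i1) q1) (xi2' : chom (q' \o1 i2) q2),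
     exists! eta : chom q q',
       xi1' \v (eta \wr i1) = xi1 /\ xi2' \v (eta \wr i2) = xi2).

Definition is_kernel21 A B (f : hom21 A B) K (k : hom21 K A)
    (eps : chom (f \o1 k) (zero1 K B)) : Prop :=
  forall X (x : hom21 X A) (eps' : chom (f \o1 x) (zero1 X B)),
  let factors (x' : hom21 X K) (e : chom (k \o1 x') x) : Prop :=
    eps' \v (f \wl e)
    = zero_comp x' B \v (eps \wr x') \v eq_cell (assoc21 f k x') in
  (exists (x' : hom21 X K) (e : chom (k \o1 x') x), factors x' e) /\
  (forall (x0 x1 : hom21 X K) (e0 : chom (k \o1 x0) x) (e1 : chom (k \o1 x1) x),
     factors x0 e0 -> factors x1 e1 ->
     exists! xi : chom x0 x1, e1 \v (k \wl xi) = e0).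

Definition is_cokernel21 A B (f : hom21 A B) C (c : hom21 B C)
    (eps : chom (c \o1 f) (zero1 A C)) : Prop :=
  forall X (x : hom21 B X) (eps' : chom (x \o1 f) (zero1 A X)),
  let factors (x' : hom21 C X) (e : chom (x' \o1 c) x) : Prop :=
    eps' \v (e \wr f) \v eq_cell (assoc21 x' c f)
    = comp_zero x' A \v (x' \wl eps) in
  (exists (x' : hom21 C X) (e : chom (x' \o1 c) x), factors x' e) /\
  (forall (x0 x1 : hom21 C X) (e0 : chom (x0 \o1 c) x) (e1 : chom (x1 \o1 c) x),
     factors x0 e0 -> factors x1 e1 ->
     exists! xi : chom x0 x1, e1 \v (xi \wr c) = e0).

Definition faithful21 A B (f : hom21 A B) : Prop :=
  forall X (a b : hom21 X A) (p q : chom a b), f \wl p = f \wl q -> p = q.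

Definition cofaithful21 A B (f : hom21 A B) : Prop :=
  forall X (a b : hom21 B X) (p q : chom a b), p \wr f = q \wr f -> p = q.

(* Nakaoka's locally SCG-categories, without his condition (a3-1). *)
Record locally_scg : Prop := {
  ls_zero : exists Z, zero_object21 Z;
  ls_product : forall A1 A2, exists P (p1 : hom21 P A1) (p2 : hom21 P A2),
    is_product21 p1 p2;
  ls_coproduct : forall A1 A2, exists P (i1 : hom21 A1 P) (i2 : hom21 A2 P),
    is_coproduct21 i1 i2
}.

Record relatively_exact : Prop := {
  re_locally_scg : locally_scg;
  re_kernel : forall A B (f : hom21 A B), exists K (k : hom21 K A)
    (eps : chom (f \o1 k) (zero1 K B)), is_kernel21 eps;
  re_cokernel : forall A B (f : hom21 A B), exists C (c : hom21 B C)
    (eps : chom (c \o1 f) (zero1 A C)), is_cokernel21 eps;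
  re_faithful : forall A B (f : hom21 A B), faithful21 f ->
    forall C (c : hom21 B C) (eps : chom (c \o1 f) (zero1 A C)),
    is_cokernel21 eps -> is_kernel21 eps;
  re_cofaithful : forall A B (f : hom21 A B), cofaithful21 f ->
    forall K (k : hom21 K A) (eps : chom (f \o1 k) (zero1 K B)),
    is_kernel21 eps -> is_cokernel21 eps
}.

End RelativelyExact.

Section DGCells.
Variables (k : comPzRingType) (A : dgcat k).
Implicit Types X Y Z W : A.

Record dgcell X Y (f g : dghom X Y 0) := DGCell {
  cellval : dghom X Y (-1);
  cell_d : cd (erefl : 0 = -1 + 1 :> int) cellval = g - f
}.

Lemma dgcell_inj X Y (f g : dghom X Y 0) (p q : dgcell f g) :
  cellval p = cellval q -> p = q.
Proof.
case: p q => [u eu] [v ev] /= euv; subst v.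
by rewrite (eq_irrelevance eu ev).
Qed.

Section HomCat.
Variables X Y : A.
Implicit Types f g : dghom X Y 0.

Fact zcell_d f g : f = g ->
  cd (erefl : 0 = -1 + 1 :> int) (0 : dghom X Y (-1)) = g - f.
Proof. by move=> ->; rewrite cd0 subrr. Qed.

Definition zcell f g (e : f = g) : dgcell f g := DGCell (zcell_d e).

Fact vcell_d f g h (q : dgcell g h) (p : dgcell f g) :
  cd (erefl : 0 = -1 + 1 :> int) (cellval q + cellval p) = h - f.
Proof. by rewrite cdD !cell_d addrA subrK. Qed.

Definition vcell f g h (q : dgcell g h) (p : dgcell f g) : dgcell f h :=
  DGCell (vcell_d q p).

Fact vcell_assoc f g h l (r : dgcell h l) (q : dgcell g h) (p : dgcell f g) :
  vcell r (vcell q p) = vcell (vcell r q) p.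
Proof. by apply: dgcell_inj; rewrite /= addrA. Qed.

Fact vcell_idl f g (p : dgcell f g) : vcell (zcell (erefl g)) p = p.
Proof. by apply: dgcell_inj; rewrite /= add0r. Qed.

Fact vcell_idr f g (p : dgcell f g) : vcell p (zcell (erefl f)) = p.
Proof. by apply: dgcell_inj; rewrite /= addr0. Qed.

Definition dg_homcat : category :=
  @Category (dghom X Y 0) (@dgcell X Y) (fun f => zcell (erefl f))
    vcell vcell_assoc vcell_idl vcell_idr.

Lemma cellval_eq_cell f g (e : f = g) :
  cellval (@eq_cell dg_homcat f g e : dgcell f g) = 0.
Proof. by case: _ / e. Qed.

Fact tcell_d f f' g g' (p : dgcell f f') (q : dgcell g g') :
  cd (erefl : 0 = -1 + 1 :> int) (cellval p + cellval q) = f' + g' - (f + g).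
Proof. by rewrite cdD !cell_d opprD addrACA. Qed.

Definition tcell f f' g g' (p : dgcell f f') (q : dgcell g g') :
  dgcell (f + g) (f' + g') := DGCell (tcell_d p q).

Fact inv_cell_d f g (p : dgcell f g) :
  cd (erefl : 0 = -1 + 1 :> int) (- cellval p) = f - g.
Proof. by rewrite cdN cell_d opprB. Qed.

Fact cell_invertible f g (p : dgcell f g) : exists q : dgcell g f,
  vcell q p = zcell (erefl f) /\ vcell p q = zcell (erefl g).
Proof.
exists (DGCell (inv_cell_d p)).
by split; apply: dgcell_inj; rewrite /= (addNr, subrr).
Qed.

Definition dg_scg : scg dg_homcat.
Proof.
refine (@SCG dg_homcat +%R tcell _ _ (0 : dghom X Y 0)
  (fun a b c => zcell (esym (addrA a b c))) (fun a => zcell (add0r a))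
  (fun a => zcell (addr0 a)) (fun a b => zcell (addrC a b))
  _ _ _ _ _ _ _ _ cell_invertible _).
- by move=> a b; apply: dgcell_inj; rewrite /= addr0.
- by move=> *; apply: dgcell_inj; rewrite /= addrACA.
- by move=> *; apply: dgcell_inj; rewrite /= add0r addr0 addrA.
- by move=> *; apply: dgcell_inj; rewrite /= !(add0r, addr0).
- by move=> *; apply: dgcell_inj; rewrite /= !(add0r, addr0).
- by move=> *; apply: dgcell_inj; rewrite /= add0r addr0 addrC.
- by move=> *; apply: dgcell_inj; rewrite /= !(add0r, addr0).
- by move=> *; apply: dgcell_inj; rewrite /= !(add0r, addr0).
- by move=> *; apply: dgcell_inj; rewrite /= !(add0r, addr0).
- by move=> *; apply: dgcell_inj; rewrite /= !(add0r, addr0).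
- by move=> a; exists (- a : dghom X Y 0); split; apply: (zcell (subrr a)).
Defined.

End HomCat.

Definition dgcomp00 X Y Z (g : dghom Y Z 0) (f : dghom X Y 0) : dghom X Z 0 :=
  dgcomp (erefl : 0 = 0 + 0 :> int) g f.

Definition dglwhisk X Y Z (g : dghom Y Z 0) (u : dghom X Y (-1)) :
  dghom X Z (-1) := dgcomp (erefl : -1 = 0 + -1 :> int) g u.
Definition dgrwhisk X Y Z (v : dghom Y Z (-1)) (f : dghom X Y 0) :
  dghom X Z (-1) := dgcomp (erefl : -1 = -1 + 0 :> int) v f.

Lemma cd_dg0 X Y i (e : i = 0 + 1) (f : dghom X Y 0) : cd e f = 0.
Proof. by subst i; apply: dg_nonpositive. Qed.

Lemma cd_dglwhisk X Y Z (g : dghom Y Z 0) (u : dghom X Y (-1)) :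
  cd (erefl : 0 = -1 + 1 :> int) (dglwhisk g u)
  = dgcomp00 g (cd (erefl : 0 = -1 + 1 :> int) u).
Proof.
rewrite (dg_leibniz _ _ (erefl : 1 = 0 + 1 :> int) (erefl : 0 = 1 + -1 :> int)
  (erefl : 0 = -1 + 1 :> int) (erefl : 0 = 0 + 0 :> int)).
by rewrite cd_dg0 dgcomp0l add0r [_ ^+ _]expr0 scale1r.
Qed.

Lemma cd_dgrwhisk X Y Z (v : dghom Y Z (-1)) (f : dghom X Y 0) :
  cd (erefl : 0 = -1 + 1 :> int) (dgrwhisk v f)
  = dgcomp00 (cd (erefl : 0 = -1 + 1 :> int) v) f.
Proof.
rewrite (dg_leibniz _ _ (erefl : 0 = -1 + 1 :> int) (erefl : 0 = 0 + 0 :> int)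
  (erefl : 1 = 0 + 1 :> int) (erefl : 0 = -1 + 1 :> int)).
by rewrite cd_dg0 dgcomp0r scaler0 addr0.
Qed.

Fact hcell_d X Y Z (g g' : dghom Y Z 0) (f f' : dghom X Y 0)
    (q : dgcell g g') (p : dgcell f f') :
  cd (erefl : 0 = -1 + 1 :> int)
     (dglwhisk g (cellval p) + dgrwhisk (cellval q) f')
  = dgcomp00 g' f' - dgcomp00 g f.
Proof.
rewrite cdD cd_dglwhisk cd_dgrwhisk !cell_d.
by rewrite /dgcomp00 dgcompBr dgcompBl addrC addrA subrK.
Qed.

Definition hcell X Y Z (g g' : dghom Y Z 0) (f f' : dghom X Y 0)
    (q : dgcell g g') (p : dgcell f f') :
  dgcell (dgcomp00 g f) (dgcomp00 g' f') := DGCell (hcell_d q p).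

Hypothesis A_strict : strict_truncated2 A.

Lemma hcellE X Y Z (g g' : dghom Y Z 0) (f f' : dghom X Y 0)
    (q : dgcell g g') (p : dgcell f f') :
  cellval (hcell q p) = dglwhisk g' (cellval p) + dgrwhisk (cellval q) f.
Proof.
rewrite /=; case: p q => [u eu] [v ev] /=.
have := dg_leibniz (erefl : -2 = -1 + -1 :> int) (erefl : -1 = -2 + 1 :> int)
  (erefl : 0 = -1 + 1 :> int) (erefl : -1 = 0 + -1 :> int)
  (erefl : 0 = -1 + 1 :> int) (erefl : -1 = -1 + 0 :> int) v u.
rewrite eu ev (A_strict _ (dgcomp _ _ _)) // cd0 [_ ^+ _]expr1 scaleN1r.
rewrite dgcompBl dgcompBr -!/(dglwhisk _ _) -!/(dgrwhisk _ _) => h.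
apply/esym/eqP; rewrite -subr_eq0 opprD addrACA -[X in _ + X]opprB.
by rewrite -h.
Qed.

Definition dg_cat21 : cat21.
Proof.
refine (@Cat21 A dg_homcat (@dgid k A) dgcomp00 hcell _ _
  (fun X Y Z W h g f => dgcomp_assoc _ _ _ _ h g f)
  (fun X Y f => dgcomp_idl _ f) (fun X Y f => dgcomp_idr _ f) _ _ _
  (fun X Y f g p => cell_invertible p)).
- move=> X Y Z g f; apply: dgcell_inj.
  by rewrite /= /dglwhisk /dgrwhisk dgcomp0l dgcomp0r addr0.
- move=> X Y Z g g' g'' f f' f'' q' q p' p; apply: dgcell_inj.
  have := hcellE q p'; rewrite /= /dglwhisk /dgrwhisk dgcompDl dgcompDr => e.
  rewrite [X in _ + X = _]addrC addrACA e [X in _ = _ + X]addrC [RHS]addrACA.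
  by rewrite [X in _ + X = _]addrC.
- move=> X Y Z W h h' g g' f f' r q p; apply: dgcell_inj.
  rewrite /= !cellval_eq_cell add0r addr0 /dglwhisk /dgrwhisk.
  rewrite dgcompDl dgcompDr addrA.
  by congr (_ + _ + _); apply: dgcomp_assoc.
- move=> X Y f f' p; apply: dgcell_inj.
  rewrite /= !cellval_eq_cell add0r addr0 /dglwhisk /dgrwhisk dgcomp0l addr0.
  exact: dgcomp_idl.
- move=> X Y f f' p; apply: dgcell_inj.
  rewrite /= !cellval_eq_cell add0r addr0 /dglwhisk /dgrwhisk dgcomp0r add0r.
  exact: dgcomp_idr.
Defined.

Definition dg_post X Y (f : dghom X Y 0) Z :
  monoidal (dg_scg Z X) (dg_scg Z Y) (@post21 dg_cat21 X Y f Z).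
Proof.
refine (@Monoidal _ _ (dg_scg Z X) (dg_scg Z Y) (@post21 dg_cat21 X Y f Z)
  (fun a b => zcell (dgcompDr _ f a b)) (zcell (dgcomp0r _ _ f)) _ _ _ _).
- move=> a a' b b' p q; apply: dgcell_inj => /=.
  rewrite /dglwhisk /dgrwhisk !dgcomp0l !addr0 add0r.
  exact: dgcompDr.
- move=> a b c; apply: dgcell_inj => /=.
  by rewrite /dglwhisk /dgrwhisk !(dgcomp0l, dgcomp0r, addr0).
- move=> a; apply: dgcell_inj => /=.
  by rewrite /dglwhisk /dgrwhisk !(dgcomp0l, dgcomp0r, addr0).
- move=> a; apply: dgcell_inj => /=.
  by rewrite /dglwhisk /dgrwhisk !(dgcomp0l, dgcomp0r, addr0).
Defined.

Definition dg_pre X Y (f : dghom X Y 0) Z :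
  monoidal (dg_scg Y Z) (dg_scg X Z) (@pre21 dg_cat21 X Y f Z).
Proof.
refine (@Monoidal _ _ (dg_scg Y Z) (dg_scg X Z) (@pre21 dg_cat21 X Y f Z)
  (fun a b => zcell (dgcompDl _ a b f)) (zcell (dgcomp0l _ _ f)) _ _ _ _).
- move=> a a' b b' p q; apply: dgcell_inj => /=.
  rewrite /dglwhisk /dgrwhisk !dgcomp0r !add0r addr0.
  exact: dgcompDl.
- move=> a b c; apply: dgcell_inj => /=.
  by rewrite /dglwhisk /dgrwhisk !(dgcomp0l, dgcomp0r, addr0).
- move=> a; apply: dgcell_inj => /=.
  by rewrite /dglwhisk /dgrwhisk !(dgcomp0l, dgcomp0r, addr0).
- move=> a; apply: dgcell_inj => /=.
  by rewrite /dglwhisk /dgrwhisk !(dgcomp0l, dgcomp0r, addr0).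
Defined.

Definition dgcat_SCG : pre_scg_cat.
Proof.
refine (@PreSCGCat dg_cat21 dg_scg (fun X Y Z => dgcomp0l _ _ _) dg_post dg_pre _ _).
- by move=> X Y Z; apply: dgcell_inj; rewrite [RHS]cellval_eq_cell.
- by move=> X Y Z; apply: dgcell_inj; rewrite [RHS]cellval_eq_cell.
Defined.

End DGCells.

(* Main.v *)
Require Import Defs.
From mathcomp Require Import all_boot all_algebra.
From mathcomp Require Import boolp.

(* Strictness leaves only degrees -1 and 0, and Leibniz in degree -2 becomes
   the exchange law [d v . u = v . d u] for u, v of degree -1.  A three-term
   homotopy complex (f, g, h) is then the same as a 2-cell [g f => 0], and both
   "homotopy kernel" and "2-kernel" unfold to one elementary condition
   ([is_hker]): surjectivity on H^0 is the existence of factorizations, while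
   injectivity on H^0 together with bijectivity on H^-1 is the existence and
   uniqueness of the comparison 2-cell.  Likewise 2-monomorphisms and faithful
   1-cells are both the f with [f . -] injective on closed morphisms of degree
   -1.  By the exchange law homotopic morphisms act equally on these, so
   biproducts of H^0 are 2-products and 2-coproducts; conversely the
   injections of a biproduct come from the universal property of a 2-product. *)

Set Implicit Arguments.
Unset Strict Implicit.
Unset Printing Implicit Defensive.

Import GRing.Theory.
Local Open Scope ring_scope.

(** * Maps induced on cohomology, in terms of cocycles *)

Lemma bijective_inj_surj (T U : Type) (f : T -> U) :
  bijective f <-> injective f /\ forall y, exists x, f x = y.
Proof.
split=> [[g fK gK]|[f_inj f_surj]].
  by split; [exact: can_inj fK | move=> y; exists (g y)].
(* Preimages are chosen by the axiom of choice; the name is qualified because [cid] is also the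
   identity morphism of a [category]. *)
have fK y : {x | f x = y} by apply: boolp.cid.
exists (fun y => sval (fK y)) => x; last exact: svalP (fK x).
by apply: f_inj; exact: svalP (fK (f x)).
Qed.

Lemma chfunD (k : comPzRingType) (M N : complex k) (phi : chmap M N) i (x y : M i) :
  phi i (x + y) = phi i x + phi i y.
Proof. by have := chfun_linear phi 1 x y; rewrite !scale1r. Qed.

Lemma chfunN (k : comPzRingType) (M N : complex k) (phi : chmap M N) i (x : M i) :
  phi i (- x) = - phi i x.
Proof. by have := chfunB phi 0 x; rewrite chfun0 !sub0r. Qed.

Lemma cls0 (k : comPzRingType) (M : complex k) i : cls (0 : cocycle M i) = 0.
Proof.
by have := clsD (0 : cocycle M i) 0; rewrite addr0 -{1}[cls 0]addr0 => /addrI.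
Qed.

Section Cohomology.
Variables (k : comPzRingType) (M N : complex k) (phi : chmap M N) (i : int).
Local Notation d_in := (cd (esym (subrK 1 i))).
Local Notation d_out := (cd (erefl (i + 1))).

(** The difference of two representatives is again a cocycle, so injectivity reduces to triviality
    of the kernel, with no quotient left in the criterion. *)
Lemma cohom_map_injP :
  injective (cohom_map phi (i := i)) <->
  forall z : M i, d_out z = 0 -> (exists x : N (i - 1), d_in x = phi i z) ->
    exists y : M (i - 1), d_in y = z.
Proof.
split=> [phi_inj z dz [x dx] | phi_inj a b].
  have zP := cocycleP dz; have zP0 := cocycleP (cd0 M (erefl (i + 1))).
  suff /cls_eqP[y dy] : cls (Cocycle z zP) = cls (Cocycle 0 zP0).
    by exists y; rewrite dy subr0.
  apply: phi_inj; rewrite !cohom_map_cls; apply/cls_eqP.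
  by exists x; rewrite dx /= chfun0 subr0.
rewrite -[a]creprK -[b]creprK !cohom_map_cls => /cls_eqP[x dx].
apply/cls_eqP; apply: phi_inj; first by rewrite cdB !cdK0 subrr.
by exists x; rewrite dx chfunB.
Qed.

Lemma cohom_map_surjP :
  (forall c, exists b, cohom_map phi (i := i) b = c) <->
  forall z : N i, d_out z = 0 -> exists (y : M i) (x : N (i - 1)),
    d_out y = 0 /\ d_in x = phi i y - z.
Proof.
split=> [phi_surj z dz | phi_surj c].
  have [b] := phi_surj (cls (Cocycle z (cocycleP dz))).
  rewrite -[b]creprK cohom_map_cls => /cls_eqP[x dx].
  by exists (crepr b), x; split; first exact: cdK0.
rewrite -[c]creprK; have [y [x [dy dx]]] := phi_surj _ (cdK0 (crepr c) erefl).
by exists (cls (Cocycle y (cocycleP dy))); rewrite cohom_map_cls;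
   apply/cls_eqP; exists x.
Qed.

(** Disposes of the degrees at most -2, where strictness makes both complexes vanish. *)
Lemma cohom_map_bij0 : (forall x : M i, x = 0) -> (forall x : N i, x = 0) ->
  bijective (cohom_map phi (i := i)).
Proof.
move=> M0 N0; apply/bijective_inj_surj; split.
  by apply/cohom_map_injP => z _ _; exists 0; rewrite cd0 [RHS]M0.
apply/cohom_map_surjP => z _; exists 0, 0.
by rewrite !cd0 chfun0 [z]N0 subr0.
Qed.

End Cohomology.

(** * Calculus of degrees 0 and -1 in a strict 2-truncated DG-category *)

Section StrictTruncated.
Variables (k : comPzRingType) (A : dgcat k).
Hypothesis A_strict : strict_truncated2 A.
Implicit Types X Y Z W : A.

Local Notation dm := (cd (erefl : 0 = -1 + 1 :> int)).
Local Notation "g \00 f" := (dgcomp00 g f) (at level 40, left associativity).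
Local Notation "g \01 f" := (dglwhisk g f) (at level 40, left associativity).
Local Notation "g \10 f" := (dgrwhisk g f) (at level 40, left associativity).

Lemma dgcomp_irr X Y Z i j n (e e' : n = i + j)
    (g : dghom Y Z i) (f : dghom X Y j) : dgcomp e g f = dgcomp e' g f.
Proof. by rewrite (eq_irrelevance e e'). Qed.

Lemma cd_irr (M : complex k) i j (e e' : j = i + 1) (x : M i) : cd e x = cd e' x.
Proof. by rewrite (eq_irrelevance e e'). Qed.

Lemma cell_exchange X Y Z (v : dghom Y Z (-1)) (u : dghom X Y (-1)) :
  dm v \01 u = v \10 dm u.
Proof.
have := dg_leibniz (erefl : -2 = -1 + -1 :> int) (erefl : -1 = -2 + 1 :> int)
  (erefl : 0 = -1 + 1 :> int) (erefl : -1 = 0 + -1 :> int)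
  (erefl : 0 = -1 + 1 :> int) (erefl : -1 = -1 + 0 :> int) v u.
rewrite (A_strict _ (dgcomp _ _ _)) // cd0 [_ ^+ _]expr1 scaleN1r.
by move/esym/eqP; rewrite subr_eq0 => /eqP.
Qed.

(** * Homotopy kernels and cokernels against 2-kernels and 2-cokernels *)

Section HomotopyKernel.
Variables (X Y Z : A) (f : dghom X Y 0) (g : dghom Y Z 0) (h : dghom X Z (-1)).

(** The second clause is linearised: [u] stands for the difference of two factorizations, [v] for
    the difference of their structure cells, and [w] for the 2-cell between them. *)
Definition is_hker : Prop := forall W,
  (forall (y : dghom W Y 0) (z : dghom W Z (-1)), dm z = - (g \00 y) ->
     exists (u : dghom W X 0) (e : dghom W Y (-1)),
       dm e = y - f \00 u /\ z + g \01 e = h \10 u) /\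
  (forall (u : dghom W X 0) (v : dghom W Y (-1)),
     dm v = f \00 u -> g \01 v = - (h \10 u) ->
     exists! w : dghom W X (-1), dm w = u /\ f \01 w = v).

Definition is_hcoker : Prop := forall W,
  (forall (y : dghom Y W 0) (x : dghom X W (-1)), dm x = - (y \00 f) ->
     exists (u : dghom Z W 0) (e : dghom Y W (-1)),
       dm e = y - u \00 g /\ x + e \10 f = u \01 h) /\
  (forall (u : dghom Z W 0) (v : dghom Y W (-1)),
     dm v = u \00 g -> v \10 f = - (u \01 h) ->
     exists! w : dghom Z W (-1), dm w = u /\ w \10 g = v).

End HomotopyKernel.

(** A 2-cell is determined by its value and identity cells have value 0, so only the whiskering
    survives in the horizontal composite. *)
Lemma lwhisk_cellE X Y Z (f : dghom Y Z 0) (u u' : dghom X Y 0)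
    (y : dghom X Z 0) (p : dgcell u u') (e : dgcell (f \00 u') y)
    (e' : dgcell (f \00 u) y) :
  (vcell e (@hcomp (dgcat_SCG A_strict) X Y Z f f u u' (zcell erefl) p) = e') <->
  cellval e + f \01 cellval p = cellval e'.
Proof.
split=> [<- | E]; first by rewrite /= /dgrwhisk dgcomp0l addr0.
by apply: dgcell_inj; rewrite /= /dgrwhisk dgcomp0l addr0.
Qed.

Lemma rwhisk_cellE X Y Z (g : dghom X Y 0) (u u' : dghom Y Z 0)
    (y : dghom X Z 0) (p : dgcell u u') (e : dgcell (u' \00 g) y)
    (e' : dgcell (u \00 g) y) :
  (vcell e (@hcomp (dgcat_SCG A_strict) X Y Z u u' g g p (zcell erefl)) = e') <->
  cellval e + cellval p \10 g = cellval e'.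
Proof.
split=> [<- | E]; first by rewrite /= /dglwhisk dgcomp0r add0r.
by apply: dgcell_inj; rewrite /= /dglwhisk dgcomp0r add0r.
Qed.

(** The associativity and zero coherence cells have value 0, which leaves a single equation in
    degree -1, the one in the first clause of [is_hker]. *)
Lemma kernel_factorsE X Y Z W (f : dghom X Y 0) (g : dghom Y Z 0)
    (eps : dgcell (g \00 f) 0) (y : dghom W Y 0) (z : dgcell (g \00 y) 0)
    (u : dghom W X 0) (e : dgcell (f \00 u) y) :
  let S := dgcat_SCG A_strict in
  (vcell z (@hcomp S W Y Z g g (f \00 u) y (zcell erefl) e)
   = vcell (vcell (@zero_comp S W X u Z)
                  (@hcomp S W X Z (g \00 f) 0 u u eps (zcell erefl)))
           (eq_cell (@assoc21 S _ _ _ _ g f u))) <->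
  cellval z + g \01 cellval e = cellval eps \10 u.
Proof.
move=> S; apply: (iff_trans (lwhisk_cellE _ _ _)).
by rewrite /= cellval_eq_cell /dglwhisk dgcomp0r !add0r addr0.
Qed.

Lemma cokernel_factorsE X Y Z W (f : dghom X Y 0) (g : dghom Y Z 0)
    (eps : dgcell (g \00 f) 0) (y : dghom Y W 0) (x : dgcell (y \00 f) 0)
    (u : dghom Z W 0) (e : dgcell (u \00 g) y) :
  let S := dgcat_SCG A_strict in
  (vcell (vcell x (@hcomp S X Y W (u \00 g) y f f e (zcell erefl)))
         (eq_cell (@assoc21 S _ _ _ _ u g f))
   = vcell (@comp_zero S Z W u X)
           (@hcomp S X Z W u u (g \00 f) 0 (zcell erefl) eps)) <->
  cellval x + cellval e \10 f = u \01 cellval eps.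
Proof.
move=> S; split=> [/(congr1 (@cellval _ _ _ _ _ _)) | E].
  by rewrite /= cellval_eq_cell /dglwhisk /dgrwhisk dgcomp0r dgcomp0l
             !add0r !addr0.
apply: dgcell_inj.
by rewrite /= cellval_eq_cell /dglwhisk /dgrwhisk dgcomp0r dgcomp0l
           !add0r !addr0.
Qed.

Lemma is_kernel21P X Y Z (f : dghom X Y 0) (g : dghom Y Z 0)
    (eps : dgcell (g \00 f) 0) :
  @is_kernel21 (dgcat_SCG A_strict) Y Z g X f eps <-> is_hker f g (cellval eps).
Proof.
split=> H W.
  split=> [y z dz | u v dv gv].
    have dz' : dm z = 0 - g \00 y by rewrite dz sub0r.
    have [[u [e /kernel_factorsE E]] _] := H W y (DGCell dz').
    by exists u, (cellval e); split; first exact: cell_d.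
  (* Two factorizations of [f u] are compared: [0] with the cell [v], and [u] with the identity
     cell. The 2-cell between them is the required [w]. *)
  have dv' : dm v = f \00 u - f \00 0 by rewrite /dgcomp00 dgcomp0r subr0.
  have dhu : dm (cellval eps \10 u) = 0 - g \00 (f \00 u).
    rewrite cd_dgrwhisk cell_d !sub0r /dgcomp00 dgcompNl; congr (- _).
    exact/esym/dgcomp_assoc.
  have [] := (H W (f \00 u) (DGCell dhu)).2 0 u (DGCell dv') (zcell erefl).
  - by apply/kernel_factorsE; rewrite /= gv subrr /dgrwhisk dgcomp0r.
  - by apply/kernel_factorsE; rewrite /= /dglwhisk dgcomp0r addr0.
  move=> w [/lwhisk_cellE /= wv w_uniq]; exists (cellval w); split.
    by split; [rewrite cell_d subr0 | rewrite -wv add0r].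
  move=> w' [dw' fw']; have dw0 : dm w' = u - 0 by rewrite subr0.
  by rewrite (w_uniq (DGCell dw0)) //; apply/lwhisk_cellE; rewrite /= add0r.
move=> y z; split.
  have dz : dm (cellval z) = - (g \00 y) by rewrite cell_d sub0r.
  have [u [e [de E]]] := (H W).1 y _ dz.
  by exists u, (DGCell de); apply/kernel_factorsE.
move=> u0 u1 e0 e1 /kernel_factorsE E0 /kernel_factorsE E1.
(* Subtracting the two factorizations produces the data of the second clause. *)
have [||w [[dw fw] w_uniq]] := (H W).2 (u1 - u0) (cellval e0 - cellval e1).
- by rewrite cdB !cell_d /dgcomp00 dgcompBr opprB addrC addrA subrK.
- rewrite /dglwhisk /dgrwhisk dgcompBr dgcompBr -!/(_ \01 _) -!/(_ \10 _).
  by rewrite -E0 -E1 opprB opprD addrACA subrr add0r.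
exists (DGCell dw); split.
  by apply/lwhisk_cellE; rewrite /= fw addrC subrK.
move=> w' /lwhisk_cellE E; apply: dgcell_inj; apply: w_uniq.
by split; [exact: cell_d | rewrite -E addrC addKr].
Qed.

(** The argument of [is_kernel21P] with the whiskerings on the other side. *)
Lemma is_cokernel21P X Y Z (f : dghom X Y 0) (g : dghom Y Z 0)
    (eps : dgcell (g \00 f) 0) :
  @is_cokernel21 (dgcat_SCG A_strict) X Y f Z g eps <->
  is_hcoker f g (cellval eps).
Proof.
split=> H W.
  split=> [y x dx | u v dv vf].
    have dx' : dm x = 0 - y \00 f by rewrite dx sub0r.
    have [[u [e /cokernel_factorsE E]] _] := H W y (DGCell dx').
    by exists u, (cellval e); split; first exact: cell_d.
  have dv' : dm v = u \00 g - 0 \00 g by rewrite /dgcomp00 dgcomp0l subr0.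
  have duh : dm (u \01 cellval eps) = 0 - u \00 g \00 f.
    rewrite cd_dglwhisk cell_d !sub0r /dgcomp00 dgcompNr; congr (- _).
    exact/dgcomp_assoc.
  have [] := (H W (u \00 g) (DGCell duh)).2 0 u (DGCell dv') (zcell erefl).
  - by apply/cokernel_factorsE; rewrite /= vf subrr /dglwhisk dgcomp0l.
  - by apply/cokernel_factorsE; rewrite /= /dgrwhisk dgcomp0l addr0.
  move=> w [/rwhisk_cellE /= wv w_uniq]; exists (cellval w); split.
    by split; [rewrite cell_d subr0 | rewrite -wv add0r].
  move=> w' [dw' wg']; have dw0 : dm w' = u - 0 by rewrite subr0.
  by rewrite (w_uniq (DGCell dw0)) //; apply/rwhisk_cellE; rewrite /= add0r.
move=> y x; split.
  have dx : dm (cellval x) = - (y \00 f) by rewrite cell_d sub0r.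
  have [u [e [de E]]] := (H W).1 y _ dx.
  by exists u, (DGCell de); apply/cokernel_factorsE.
move=> u0 u1 e0 e1 /cokernel_factorsE E0 /cokernel_factorsE E1.
have [||w [[dw wg] w_uniq]] := (H W).2 (u1 - u0) (cellval e0 - cellval e1).
- by rewrite cdB !cell_d /dgcomp00 dgcompBl opprB addrC addrA subrK.
- rewrite /dglwhisk /dgrwhisk dgcompBl dgcompBl -!/(_ \01 _) -!/(_ \10 _).
  by rewrite -E0 -E1 opprB opprD addrACA subrr add0r.
exists (DGCell dw); split.
  by apply/rwhisk_cellE; rewrite /= wg addrC subrK.
move=> w' /rwhisk_cellE E; apply: dgcell_inj; apply: w_uniq.
by split; [exact: cell_d | rewrite -E addrC addKr].
Qed.

(** * The mapping fibre in degrees 0 and -1, and exactness *)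

Lemma castdeg_id (M : complex k) i (e : i = i) (x : M i) : castdeg e x = x.
Proof. by rewrite (eq_irrelevance e erefl). Qed.

Section FibDegrees.
Variables (M N : complex k) (phi : chmap M N).
Hypothesis M_pos : forall x : M 1, x = 0.
Hypothesis N_neg : forall i : int, i <= -2 -> forall x : N i, x = 0.

(** Since [M] vanishes in degree 1, only the second component of the differential is a condition: a
    0-cocycle is an element with, up to sign, a nullhomotopy of its image. *)
Lemma fib_cocycle0 (x : Fib phi 0) :
  cd (erefl (0 + 1)) x = 0 <-> dm x.2 = - phi 0 x.1.
Proof.
rewrite /= /fib_d (castdeg_id (i := 0)) (cd_irr _ (erefl : 0 = -1 + 1 :> int)).
split=> [[_ /eqP] | E].
  by rewrite subr_eq0 => /eqP.
by rewrite E (subrr (- phi 0 x.1)) [cd _ x.1]M_pos.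
Qed.

(** In degree -1 the second component of the fibre lies in degree -2 of [N], hence is 0. *)
Lemma fib_boundary0 (x : Fib phi (0 - 1)) (y : Fib phi 0) :
  cd (esym (subrK 1 0)) x = y <-> dm x.1 = y.1 /\ - phi (-1) x.1 = y.2.
Proof.
rewrite /= /fib_d (castdeg_id (i := -1)) [x.2]N_neg // cd0 subr0.
rewrite (cd_irr _ (erefl : 0 = -1 + 1 :> int)).
by case: y => y1 y2; split=> [[-> ->] | [/= -> ->]].
Qed.

Lemma fib_cocycleN1 (x : Fib phi (-1)) :
  cd (erefl (-1 + 1)) x = 0 <-> dm x.1 = 0 /\ phi (-1) x.1 = 0.
Proof.
rewrite /= /fib_d (castdeg_id (i := -1)) [x.2]N_neg // cd0 subr0.
split=> [[-> /eqP] | [-> ->]]; last by rewrite oppr0.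
by rewrite oppr_eq0 => /eqP.
Qed.

Variables (L : complex k) (psi : chmap L (Fib phi)).
Hypothesis L_pos : forall x : L 1, x = 0.
Hypothesis L_neg : forall i : int, i <= -2 -> forall x : L i, x = 0.
Hypothesis M_neg : forall i : int, i <= -2 -> forall x : M i, x = 0.

(** Stated for any [psi] into a fibre, so that [left_map] and [right_map] are both instances.
    Solving for [w] means finding a primitive of [u] and then adjusting it by a cocycle. *)
Lemma fib_quasi_isoP :
  (forall i : int, i <= 0 -> bijective (cohom_map psi (i := i))) <->
  (forall (y : M 0) (z : N (-1)), dm z = - phi 0 y ->
     exists (u : L 0) (e : M (-1)),
       dm e = y - (psi 0 u).1 /\ z + phi (-1) e = (psi 0 u).2) /\
  (forall (u : L 0) (v : M (-1)),
     dm v = (psi 0 u).1 -> phi (-1) v = - (psi 0 u).2 ->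
     exists! w : L (-1), dm w = u /\ (psi (-1) w).1 = v).
Proof.
split=> [psi_bij | [psi_E psi_U]].
  have /bijective_inj_surj[/cohom_map_injP inj0 /cohom_map_surjP surj0] :=
    psi_bij 0 isT.
  have /bijective_inj_surj[/cohom_map_injP inj1 /cohom_map_surjP surj1] :=
    psi_bij (-1) isT.
  split=> [y z dz | u v dv phiv].
    have [//|u [x [_ /fib_boundary0[dx phix]]]] := surj0 (y, z).
      exact/fib_cocycle0.
    exists u, (- x.1); split; first by rewrite cdN dx opprB.
    by rewrite chfunN phix /= addrC subrK.
  (* As [u] maps to the boundary of [(v, 0)], injectivity on H^0 gives a primitive [w0] of [u],
     which need not map to [v]. *)
  have [||w0 dw0] := inj0 u; first exact: L_pos.
    by exists (v, 0); apply/fib_boundary0; rewrite /= phiv opprK.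
  have dw0' : dm w0 = u by rewrite -dw0; apply: cd_irr.
  have /esym/fib_boundary0[dpsi phipsi] := chfun_cd psi (esym (subrK 1 0)) w0.
  rewrite dw0 in dpsi phipsi.
  (* The defect of [w0] is a cocycle; surjectivity on H^-1 lifts it exactly, because there are no
     boundaries from degree -2. *)
  have [|y [x [dy]]] := surj1 (v - (psi (-1) w0).1, 0).
    apply/fib_cocycleN1; rewrite /= cdB dv dpsi subrr; split=> //.
    by rewrite chfunB phiv -phipsi opprK subrr.
  rewrite [x](_ : _ = 0); last first.
    by apply: injective_projections; [exact: M_neg | exact: N_neg].
  rewrite cd0 => /(congr1 fst) /= /esym/eqP; rewrite subr_eq0 => /eqP psiy.
  exists (w0 + y); split.
    split; first by rewrite cdD dw0' [X in _ + X]dy addr0.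
    rewrite chfunD /= psiy addrC; exact: subrK.
  move=> w' [dw' psiw'].
  (* Two solutions differ by a cocycle sent to 0; injectivity on H^-1 makes it a boundary from
     degree -2, hence 0. *)
  have [||r dr] := inj1 (w0 + y - w').
  - rewrite cdB cdD dy addr0.
    by apply/eqP; rewrite subr_eq0; apply/eqP; exact: etrans dw0' (esym dw').
  - exists 0; rewrite cd0; apply: injective_projections; last first.
      by rewrite [LHS]N_neg // [RHS]N_neg.
    rewrite chfunB chfunD /= psiw' psiy addrC; apply/esym/eqP.
    by rewrite addrC subr_eq0 addrC; apply/eqP; exact: subrK.
  by apply/eqP; rewrite -subr_eq0 -dr [r]L_neg // cd0.
(* [Negz n] is -(n+1), so the remaining cases are degree 0, degree -1 and degrees at most -2; the
   lowest come first. *)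
case=> [[|n]|[|n]] //= _; last first.
- by apply: cohom_map_bij0 => x; [|apply: injective_projections];
     rewrite ?[LHS]L_neg ?[LHS]M_neg ?[LHS]N_neg.
- apply/bijective_inj_surj; split.
    apply/cohom_map_injP => r dr [x].
    rewrite [x](_ : _ = 0); last first.
      by apply: injective_projections; [exact: M_neg | exact: N_neg].
    rewrite cd0 => /(congr1 fst) /esym /= psir.
    (* Both [r] and 0 solve the problem with zero data, so they coincide. *)
    have [||w [_ w_uniq]] := psi_U 0 0; rewrite ?cd0 ?chfun0 //= ?oppr0 //.
    exists 0; rewrite cd0 -(w_uniq r) // (w_uniq 0) //.
    by split; rewrite ?cd0 ?chfun0.
  apply/cohom_map_surjP => -[c z] /fib_cocycleN1[/= dc phic].
  have [||w [[dw psiw] _]] := psi_U 0 c; rewrite ?chfun0 //= ?oppr0 //.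
  exists w, 0; split; first exact: dw.
  rewrite [LHS](cd0 (Fib phi)); apply: injective_projections.
    by rewrite /= psiw subrr.
  by rewrite [LHS]N_neg // [RHS]N_neg.
apply/bijective_inj_surj; split.
  apply/cohom_map_injP => u _ [x /fib_boundary0[dx phix]].
  have [||w [[dw _] _]] := psi_U u x.1 => //; first by rewrite -phix opprK.
  by exists w; rewrite -dw; apply: cd_irr.
apply/cohom_map_surjP => -[y z] /fib_cocycle0 /= dz.
have [u [e [de E]]] := psi_E y z dz.
exists u, (- e, 0); split; first exact: L_pos.
apply/fib_boundary0; rewrite /= cdN de opprB -E chfunN opprK; split=> //.
by rewrite [z + _]addrC addrK.
Qed.

End FibDegrees.

Lemma dghom_pos X Y (x : dghom X Y 1) : x = 0.
Proof. exact: dg_nonpositive. Qed.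

(** Replacing the degree proofs by [erefl] turns the composites in [left_map] into whiskerings, and
    [fib_quasi_isoP] applies for each [W]. *)
Lemma left_exactP X Y Z (t : three_term X Y Z) :
  left_exact t <-> is_hker (cocval (tt_f t)) (cocval (tt_g t)) (tt_h t).
Proof.
have := fun W => fib_quasi_isoP (@dghom_pos W Y) (@A_strict W Z)
  (left_map t W) (@dghom_pos W X) (@A_strict W X) (@A_strict W Y).
rewrite /= /left_fun /=.
rewrite (eq_irrelevance (esym (add0r 0)) (erefl : 0 = 0 + 0 :> int)).
rewrite (eq_irrelevance (esym (add0r (-1))) (erefl : -1 = 0 + -1 :> int)).
rewrite (eq_irrelevance (addrC 0 (-1)) (erefl : -1 = -1 + 0 :> int)) => W_iff.
by split=> H W; apply/W_iff; apply: H.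
Qed.

(** The sign of [right_map] enters only in degree 0, where it is 1: in degree -1 the criterion reads
    the first component alone. *)
Lemma right_exactP X Y Z (t : three_term X Y Z) :
  right_exact t <-> is_hcoker (cocval (tt_f t)) (cocval (tt_g t)) (tt_h t).
Proof.
have := fun W => fib_quasi_isoP (@dghom_pos Y W) (@A_strict X W)
  (right_map t W) (@dghom_pos Z W) (@A_strict Z W) (@A_strict Y W).
rewrite /= /right_fun /=.
rewrite (eq_irrelevance (esym (addr0 0)) (erefl : 0 = 0 + 0 :> int)).
rewrite (eq_irrelevance (esym (addr0 (-1))) (erefl : -1 = -1 + 0 :> int)).
have sign0 W (x : dghom X W (-1)) : (-1) ^+ `|0%R : int|%N *: x = x.
  by rewrite expr0 scale1r.
move=> W_iff.
split=> H W.
  have [E U] := (W_iff W).1 (H W).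
  split=> [y x dx | u v dv vf].
    have [u [e [de xe]]] := E y x dx; exists u, e; split=> //.
    exact: etrans xe (sign0 _ _).
  by apply: U => //; apply: (etrans vf); congr (- _); exact/esym/sign0.
apply/W_iff; have [E U] := H W.
split=> [y x dx | u v dv vf].
  have [u [e [de xe]]] := E y x dx; exists u, e; split=> //.
  exact/(etrans xe)/esym/sign0.
by apply: U => //; apply: (etrans vf); congr (- _); exact: sign0.
Qed.

(** * 2-monomorphisms, 2-epimorphisms, faithful and cofaithful 1-cells *)

Lemma cell_closed X Y (a b : dghom X Y 0) (p q : dgcell a b) :
  dm (cellval p - cellval q) = 0.
Proof. by rewrite cdB !cell_d subrr. Qed.

(** With nothing in degree -2, H^-1 consists of the closed morphisms themselves, and in lower
    degrees the maps are between zero groups. *)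
Lemma mono2P X Y (f : zmor X Y) :
  mono2 f <-> forall W (u : dghom W X (-1)),
    dm u = 0 -> cocval f \01 u = 0 -> u = 0.
Proof.
split=> H W.
  have [/cohom_map_injP inj1 _] := H W => u du fu.
  have [|x <-] := inj1 u du.
    exists 0; rewrite cd0 -fu; exact: dgcomp_irr.
  by rewrite [x]A_strict // cd0.
split=> [|i i_le].
  apply/cohom_map_injP => u du [x]; rewrite [x]A_strict // cd0 => fu.
  by exists 0; rewrite cd0 (H W u du) // [RHS]fu; exact: dgcomp_irr.
by apply: cohom_map_bij0 => x; apply: A_strict.
Qed.

Lemma epi2P X Y (f : zmor X Y) :
  epi2 f <-> forall W (u : dghom Y W (-1)),
    dm u = 0 -> u \10 cocval f = 0 -> u = 0.
Proof.
split=> H W.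
  have [/cohom_map_injP inj1 _] := H W => u du uf.
  have [|x <-] := inj1 u du.
    exists 0; rewrite cd0 -uf; exact: dgcomp_irr.
  by rewrite [x]A_strict // cd0.
split=> [|i i_le].
  apply/cohom_map_injP => u du [x]; rewrite [x]A_strict // cd0 => uf.
  by exists 0; rewrite cd0 (H W u du) // [RHS]uf; exact: dgcomp_irr.
by apply: cohom_map_bij0 => x; apply: A_strict.
Qed.

(** Parallel 2-cells differ by a closed morphism of degree -1; conversely such a morphism is a
    2-cell from 0 to 0, to be compared with the identity. *)
Lemma faithful21P X Y (f : dghom X Y 0) :
  @faithful21 (dgcat_SCG A_strict) X Y f <-> forall W (u : dghom W X (-1)),
    dm u = 0 -> f \01 u = 0 -> u = 0.
Proof.
split=> H W.
  move=> u du fu; have du' : dm u = 0 - 0 by rewrite subrr.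
  suff : DGCell du' = zcell erefl by move/(congr1 (@cellval _ _ _ _ _ _)).
  apply: (H W); apply: dgcell_inj; rewrite /= /dglwhisk /dgrwhisk.
  by rewrite dgcomp0l dgcomp0r !addr0.
move=> a b p q /(congr1 (@cellval _ _ _ _ _ _)).
rewrite /= /dgrwhisk dgcomp0l !addr0 => fpq; apply: dgcell_inj.
apply/eqP; rewrite -subr_eq0; apply/eqP; apply: H; first exact: cell_closed.
by rewrite /dglwhisk dgcompBr -!/(_ \01 _) fpq subrr.
Qed.

Lemma cofaithful21P X Y (f : dghom X Y 0) :
  @cofaithful21 (dgcat_SCG A_strict) X Y f <-> forall W (u : dghom Y W (-1)),
    dm u = 0 -> u \10 f = 0 -> u = 0.
Proof.
split=> H W.
  move=> u du uf; have du' : dm u = 0 - 0 by rewrite subrr.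
  suff : DGCell du' = zcell erefl by move/(congr1 (@cellval _ _ _ _ _ _)).
  apply: (H W); apply: dgcell_inj; rewrite /= /dglwhisk /dgrwhisk.
  by rewrite dgcomp0l dgcomp0r !add0r.
move=> a b p q /(congr1 (@cellval _ _ _ _ _ _)).
rewrite /= /dglwhisk dgcomp0r !add0r => fpq; apply: dgcell_inj.
apply/eqP; rewrite -subr_eq0; apply/eqP; apply: H; first exact: cell_closed.
by rewrite /dgrwhisk dgcompBl -!/(_ \10 _) fpq subrr.
Qed.

(** * Homotopy classes, whiskering and zero objects *)

Definition zmor_of X Y (f : dghom X Y 0) : zmor X Y :=
  Cocycle f (cocycleP (cd_dg0 (erefl (0 + 1)) f)).

Lemma cls_deg0P X Y (a b : zmor X Y) :
  cls a = cls b <-> exists s, dm s = cocval a - cocval b.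
Proof.
split=> [/cls_eqP|] [s ds]; [|apply/cls_eqP];
  by exists s; rewrite -ds; apply: cd_irr.
Qed.


Lemma lwhiskA W X Y Z (g : dghom Y Z 0) (f : dghom X Y 0) (u : dghom W X (-1)) :
  g \01 (f \01 u) = (g \00 f) \01 u.
Proof. exact: dgcomp_assoc. Qed.

Lemma rwhiskA W X Y Z (u : dghom Z W (-1)) (g : dghom Y Z 0) (f : dghom X Y 0) :
  u \10 g \10 f = u \10 (g \00 f).
Proof. exact/esym/dgcomp_assoc. Qed.

Lemma comp00A W X Y Z (h : dghom Z W 0) (g : dghom Y Z 0) (f : dghom X Y 0) :
  h \00 (g \00 f) = h \00 g \00 f.
Proof. exact: dgcomp_assoc. Qed.

Lemma lwhiskDr X Y Z (g : dghom Y Z 0) (u v : dghom X Y (-1)) :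
  g \01 (u + v) = g \01 u + g \01 v.
Proof. exact: dgcompDr. Qed.

Lemma lwhiskBr X Y Z (g : dghom Y Z 0) (u v : dghom X Y (-1)) :
  g \01 (u - v) = g \01 u - g \01 v.
Proof. exact: dgcompBr. Qed.

Lemma lwhiskDl X Y Z (g g' : dghom Y Z 0) (u : dghom X Y (-1)) :
  (g + g') \01 u = g \01 u + g' \01 u.
Proof. exact: dgcompDl. Qed.

Lemma rwhiskDl X Y Z (u v : dghom Y Z (-1)) (f : dghom X Y 0) :
  (u + v) \10 f = u \10 f + v \10 f.
Proof. exact: dgcompDl. Qed.

Lemma rwhiskBl X Y Z (u v : dghom Y Z (-1)) (f : dghom X Y 0) :
  (u - v) \10 f = u \10 f - v \10 f.
Proof. exact: dgcompBl. Qed.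

Lemma rwhiskDr X Y Z (u : dghom Y Z (-1)) (f f' : dghom X Y 0) :
  u \10 (f + f') = u \10 f + u \10 f'.
Proof. exact: dgcompDr. Qed.

Lemma lwhisk_id X Y (u : dghom X Y (-1)) : dgid Y \01 u = u.
Proof. exact: dgcomp_idl. Qed.

Lemma rwhisk_id X Y (u : dghom X Y (-1)) : u \10 dgid X = u.
Proof. exact: dgcomp_idr. Qed.

Lemma lwhisk0l X Y Z (u : dghom X Y (-1)) : (0 : dghom Y Z 0) \01 u = 0.
Proof. exact: dgcomp0l. Qed.

Lemma rwhisk0r X Y Z (u : dghom Y Z (-1)) : u \10 (0 : dghom X Y 0) = 0.
Proof. exact: dgcomp0r. Qed.

(** If [s] bounds [a - b], the exchange law moves the differential from [s] to [u], where it
    vanishes. *)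
Lemma homotopic_lwhisk X Y Z (a b : dghom Y Z 0) (u : dghom X Y (-1)) :
  (exists s, dm s = a - b) -> dm u = 0 -> a \01 u = b \01 u.
Proof.
case=> s ds du; apply/eqP; rewrite -subr_eq0; apply/eqP.
have := cell_exchange s u; rewrite ds du /dglwhisk /dgrwhisk dgcompBl => ->.
exact: dgcomp0r.
Qed.

Lemma homotopic_rwhisk X Y Z (a b : dghom X Y 0) (u : dghom Y Z (-1)) :
  (exists s, dm s = a - b) -> dm u = 0 -> u \10 a = u \10 b.
Proof.
case=> s ds du; apply/eqP; rewrite -subr_eq0; apply/eqP.
have := cell_exchange u s; rewrite ds du /dglwhisk /dgrwhisk dgcompBr => <-.
exact: dgcomp0l.
Qed.

Lemma zero_object21P Z :
  zero_object21 (Z : dgcat_SCG A_strict) <-> is_zero_object (C := H0cat A) Z.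
Proof.
have cellP X Y (f : dghom X Y 0) :
    (exists s, dm s = f - 0) -> exists p : dgcell f 0, True.
  case=> s ds; suff ds' : dm (- s) = 0 - f by exists (DGCell ds').
  by rewrite cdN ds subr0 sub0r.
have clsP X Y (f : H0hom X Y) (P : dgcell (cocval (crepr f)) 0 -> Prop) :
      (exists p, P p) -> f = 0.
  case=> p _; rewrite -[f]creprK -cls0; apply/cls_deg0P; exists (- cellval p).
  by rewrite cdN cell_d sub0r opprK subr0.
split=> [H | [HX HY]].
  split=> X f; apply: clsP; first exact: (H X).1.
  exact: (H X).2.
(* The identity of [Z] is nullhomotopic, hence acts as 0 on closed morphisms of degree -1; this
   gives uniqueness of the 2-cells to zero. *)
have id0 : exists s, dm s = dgid Z - 0.
  by apply/(cls_deg0P (zmor_id Z) 0); rewrite cls0; exact: HX.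
move=> X; split=> f.
  have [p _] : exists p : dgcell f 0, True.
    by apply/cellP/(cls_deg0P (zmor_of f) 0); rewrite cls0; exact: HX.
  exists p; split=> // q _; apply: dgcell_inj; apply/eqP; rewrite -subr_eq0.
  have := homotopic_lwhisk id0 (cell_closed p q).
  by rewrite /dglwhisk dgcomp_idl dgcomp0l => ->.
have [p _] : exists p : dgcell f 0, True.
  by apply/cellP/(cls_deg0P (zmor_of f) 0); rewrite cls0; exact: HY.
exists p; split=> // q _; apply: dgcell_inj; apply/eqP; rewrite -subr_eq0.
have := homotopic_rwhisk id0 (cell_closed p q).
by rewrite /dgrwhisk dgcomp_idr dgcomp0r => ->.
Qed.

(** * Biproducts of the homotopy category as 2-products and 2-coproducts *)

Section Biproduct.
Variables (X Y P : A).

(** The terms [- 0] keep every clause in the shape expected by [cls_deg0P] and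
    [homotopic_lwhisk]. *)
Definition is_hbiproduct (i1 : dghom X P 0) (i2 : dghom Y P 0)
    (p1 : dghom P X 0) (p2 : dghom P Y 0) : Prop :=
  [/\ exists s, dm s = p1 \00 i1 - dgid X, exists s, dm s = p2 \00 i2 - dgid Y,
      exists s, dm s = p2 \00 i1 - 0, exists s, dm s = p1 \00 i2 - 0 &
      exists s, dm s = i1 \00 p1 + i2 \00 p2 - dgid P].

Lemma is_hbiproductP (i1 : zmor X P) (i2 : zmor Y P)
    (p1 : zmor P X) (p2 : zmor P Y) :
  is_biproduct (C := H0cat A) (cls i1) (cls i2) (cls p1) (cls p2) <->
  is_hbiproduct (cocval i1) (cocval i2) (cocval p1) (cocval p2).
Proof.
rewrite /is_biproduct /= /H0id !H0comp_cls -clsD -!cls0.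
split; first by case=> /cls_deg0P ? /cls_deg0P ? /cls_deg0P ? /cls_deg0P ? /cls_deg0P.
by case=> *; split; apply/cls_deg0P.
Qed.

Variables (i1 : dghom X P 0) (i2 : dghom Y P 0).
Variables (p1 : dghom P X 0) (p2 : dghom P Y 0).

(** This is the comparison half of the 2-product property after subtracting two factorizations. A
    primitive of [u] is corrected by closed morphisms, on which the biproduct identities hold
    strictly. *)
Lemma hbiproduct_lift : is_hbiproduct i1 i2 p1 p2 ->
  forall W (u : dghom W P 0) (v1 : dghom W X (-1)) (v2 : dghom W Y (-1)),
    dm v1 = p1 \00 u -> dm v2 = p2 \00 u ->
    exists! w, dm w = u /\ p1 \01 w = v1 /\ p2 \01 w = v2.
Proof.
case=> h11 h22 h21 h12 hid W u v1 v2 dv1 dv2.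
have [w0 dw0] : exists w0, dm w0 = u.
  (* Here [s] bounds [i1 p1 + i2 p2 - id], so subtracting [s u] leaves exactly [u] as
     differential. *)
  have [s ds] := hid; exists (i1 \01 v1 + i2 \01 v2 - s \10 u).
  rewrite cdB cdD !cd_dglwhisk cd_dgrwhisk dv1 dv2 ds !comp00A /dgcomp00.
  by rewrite dgcompBl dgcompDl dgcomp_idl opprB addrC subrK.
(* The errors of [w0] are closed; naming them through an existential keeps them opaque to
   rewriting. *)
have [c1 c1E] : exists c1, c1 = v1 - p1 \01 w0 by exists (v1 - p1 \01 w0).
have [c2 c2E] : exists c2, c2 = v2 - p2 \01 w0 by exists (v2 - p2 \01 w0).
have dc1 : dm c1 = 0 by rewrite c1E cdB cd_dglwhisk dw0 dv1 subrr.
have dc2 : dm c2 = 0 by rewrite c2E cdB cd_dglwhisk dw0 dv2 subrr.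
have [w [dw pw1 pw2]] : exists w, [/\ dm w = u, p1 \01 w = v1 & p2 \01 w = v2].
  exists (w0 + (i1 \01 c1 + i2 \01 c2)); split.
  - by rewrite !cdD !cd_dglwhisk dc1 dc2 dw0 /dgcomp00 !dgcomp0r !addr0.
  - rewrite !lwhiskDr !lwhiskA.
    rewrite (homotopic_lwhisk h11 dc1) (homotopic_lwhisk h12 dc2).
    by rewrite lwhisk_id lwhisk0l addr0 c1E addrC subrK.
  - rewrite !lwhiskDr !lwhiskA.
    rewrite (homotopic_lwhisk h21 dc1) (homotopic_lwhisk h22 dc2).
    by rewrite lwhisk_id lwhisk0l add0r c2E addrC subrK.
exists w; split=> // w' [dw' [pw1' pw2']].
apply/eqP; rewrite -subr_eq0; apply/eqP.
(* On the closed difference the identity acts as [i1 p1 + i2 p2], and both projections kill it. *)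
have dr : dm (w - w') = 0 by rewrite cdB dw dw' subrr.
have := homotopic_lwhisk hid dr; rewrite lwhisk_id => <-.
by rewrite lwhiskDl -!lwhiskA !lwhiskBr pw1 pw2 pw1' pw2' !subrr addr0.
Qed.

(** Mirror image of [hbiproduct_lift], with injections and projections exchanged. *)
Lemma hbiproduct_colift : is_hbiproduct i1 i2 p1 p2 ->
  forall W (u : dghom P W 0) (v1 : dghom X W (-1)) (v2 : dghom Y W (-1)),
    dm v1 = u \00 i1 -> dm v2 = u \00 i2 ->
    exists! w, dm w = u /\ w \10 i1 = v1 /\ w \10 i2 = v2.
Proof.
case=> h11 h22 h21 h12 hid W u v1 v2 dv1 dv2.
have [w0 dw0] : exists w0, dm w0 = u.
  have [s ds] := hid; exists (v1 \10 p1 + v2 \10 p2 - u \01 s).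
  rewrite cdB cdD !cd_dgrwhisk cd_dglwhisk dv1 dv2 ds -!comp00A /dgcomp00.
  by rewrite dgcompBr dgcompDr dgcomp_idr opprB addrC subrK.
have [c1 c1E] : exists c1, c1 = v1 - w0 \10 i1 by exists (v1 - w0 \10 i1).
have [c2 c2E] : exists c2, c2 = v2 - w0 \10 i2 by exists (v2 - w0 \10 i2).
have dc1 : dm c1 = 0 by rewrite c1E cdB cd_dgrwhisk dw0 dv1 subrr.
have dc2 : dm c2 = 0 by rewrite c2E cdB cd_dgrwhisk dw0 dv2 subrr.
have [w [dw wi1 wi2]] : exists w, [/\ dm w = u, w \10 i1 = v1 & w \10 i2 = v2].
  exists (w0 + (c1 \10 p1 + c2 \10 p2)); split.
  - by rewrite !cdD !cd_dgrwhisk dc1 dc2 dw0 /dgcomp00 !dgcomp0l !addr0.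
  - rewrite !rwhiskDl !rwhiskA.
    rewrite (homotopic_rwhisk h11 dc1) (homotopic_rwhisk h21 dc2).
    by rewrite rwhisk_id rwhisk0r addr0 c1E addrC subrK.
  - rewrite !rwhiskDl !rwhiskA.
    rewrite (homotopic_rwhisk h12 dc1) (homotopic_rwhisk h22 dc2).
    by rewrite rwhisk_id rwhisk0r add0r c2E addrC subrK.
exists w; split=> // w' [dw' [wi1' wi2']].
apply/eqP; rewrite -subr_eq0; apply/eqP.
have dr : dm (w - w') = 0 by rewrite cdB dw dw' subrr.
have := homotopic_rwhisk hid dr; rewrite rwhisk_id => <-.
by rewrite rwhiskDr -!rwhiskA !rwhiskBl wi1 wi2 wi1' wi2' !subrr addr0.
Qed.

Lemma hbiproduct_product21 : is_hbiproduct i1 i2 p1 p2 ->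
  @is_product21 (dgcat_SCG A_strict) X Y P p1 p2.
Proof.
move=> hb W q1 q2; split=> [|q q' xi1 xi2 xi1' xi2'].
  have [[s11 ds11] [s22 ds22] [s21 ds21] [s12 ds12] _] := hb.
  exists (i1 \00 q1 + i2 \00 q2); split; constructor.
    apply: (@DGCell _ _ _ _ _ _ (- (s11 \10 q1 + s12 \10 q2))).
    rewrite cdN cdD !cd_dgrwhisk ds11 ds12 /= /dgcomp00.
    rewrite subr0 dgcompBl dgcompDr dgcomp_idl -!/(_ \00 _) !comp00A.
    by rewrite addrAC opprB.
  apply: (@DGCell _ _ _ _ _ _ (- (s21 \10 q1 + s22 \10 q2))).
  rewrite cdN cdD !cd_dgrwhisk ds21 ds22 /= /dgcomp00.
  rewrite subr0 dgcompBl dgcompDr dgcomp_idl -!/(_ \00 _) !comp00A.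
  by rewrite addrA opprB.
have [||w [[dw [pw1 pw2]] w_uniq]] := hbiproduct_lift hb (u := q' - q)
  (v1 := cellval xi1 - cellval xi1') (v2 := cellval xi2 - cellval xi2').
- by rewrite cdB !cell_d /dgcomp00 dgcompBr opprB addrC addrA subrK.
- by rewrite cdB !cell_d /dgcomp00 dgcompBr opprB addrC addrA subrK.
exists (DGCell dw); split.
  by split; apply/lwhisk_cellE; rewrite /= ?pw1 ?pw2 addrC subrK.
move=> w' [/lwhisk_cellE E1 /lwhisk_cellE E2]; apply: dgcell_inj; apply: w_uniq.
by split; [exact: cell_d | rewrite -E1 -E2 ![_ + _ \01 _]addrC !addrK].
Qed.

Lemma hbiproduct_coproduct21 : is_hbiproduct i1 i2 p1 p2 ->
  @is_coproduct21 (dgcat_SCG A_strict) X Y P i1 i2.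
Proof.
move=> hb W q1 q2; split=> [|q q' xi1 xi2 xi1' xi2'].
  have [[s11 ds11] [s22 ds22] [s21 ds21] [s12 ds12] _] := hb.
  exists (q1 \00 p1 + q2 \00 p2); split; constructor.
    apply: (@DGCell _ _ _ _ _ _ (- (q1 \01 s11 + q2 \01 s21))).
    rewrite cdN cdD !cd_dglwhisk ds11 ds21 /= /dgcomp00.
    rewrite subr0 dgcompBr dgcompDl dgcomp_idr -!/(_ \00 _) -!comp00A.
    by rewrite addrAC opprB.
  apply: (@DGCell _ _ _ _ _ _ (- (q1 \01 s12 + q2 \01 s22))).
  rewrite cdN cdD !cd_dglwhisk ds12 ds22 /= /dgcomp00.
  rewrite subr0 dgcompBr dgcompDl dgcomp_idr -!/(_ \00 _) -!comp00A.
  by rewrite addrA opprB.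
have [||w [[dw [wi1 wi2]] w_uniq]] := hbiproduct_colift hb (u := q' - q)
  (v1 := cellval xi1 - cellval xi1') (v2 := cellval xi2 - cellval xi2').
- by rewrite cdB !cell_d /dgcomp00 dgcompBl opprB addrC addrA subrK.
- by rewrite cdB !cell_d /dgcomp00 dgcompBl opprB addrC addrA subrK.
exists (DGCell dw); split.
  by split; apply/rwhisk_cellE; rewrite /= ?wi1 ?wi2 addrC subrK.
move=> w' [/rwhisk_cellE E1 /rwhisk_cellE E2]; apply: dgcell_inj; apply: w_uniq.
by split; [exact: cell_d | rewrite -E1 -E2 ![_ + _ \10 _]addrC !addrK].
Qed.

End Biproduct.

(** The injections are the factorizations of [(id, 0)] and [(0, id)]; their structure cells are the
    four homotopies with the projections. *)
Lemma product21_hbiproduct X Y P (p1 : dghom P X 0) (p2 : dghom P Y 0) :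
  @is_product21 (dgcat_SCG A_strict) X Y P p1 p2 ->
  exists i1 i2, is_hbiproduct i1 i2 p1 p2.
Proof.
move=> prod.
have [[i1 [[c11] [c21]]] _] := prod X (dgid X) 0.
have [[i2 [[c12] [c22]]] _] := prod Y 0 (dgid Y).
have flip W Z (a b : dghom W Z 0) (p : dgcell a b) : exists s, dm s = a - b.
  by exists (- cellval p); rewrite cdN cell_d opprB.
exists i1, i2; split; [exact: flip c11 | exact: flip c22 | exact: flip c21 |
  exact: flip c12 | ].
(* Both [e] and the identity factor the pair [(p1, p2)], so the universal property supplies the
   fifth homotopy between them. *)
pose e := i1 \00 p1 + i2 \00 p2.
have de1 : dm (cellval c11 \10 p1 + cellval c12 \10 p2) = p1 - p1 \00 e.
  rewrite cdD !cd_dgrwhisk !cell_d /dgcomp00 sub0r dgcompBl dgcompNl dgcomp_idl.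
  by rewrite -!/(_ \00 _) -!comp00A /dgcomp00 dgcompDr opprD addrA.
have de2 : dm (cellval c21 \10 p1 + cellval c22 \10 p2) = p2 - p2 \00 e.
  rewrite cdD !cd_dgrwhisk !cell_d /dgcomp00 sub0r dgcompBl dgcompNl dgcomp_idl.
  by rewrite -!/(_ \00 _) -!comp00A /dgcomp00 dgcompDr opprD addrCA addrA.
have [_ /(_ e (dgid P) (DGCell de1) (DGCell de2) (zcell (dgcomp_idr _ _))
  (zcell (dgcomp_idr _ _)))[eta _]] := prod P p1 p2.
exact: flip eta.
Qed.

(** * Three-term complexes as 2-cells, and the equivalence *)

Lemma three_term_cell_d X Y Z (t : three_term X Y Z) :
  dm (tt_h t) = 0 - cocval (tt_g t) \00 cocval (tt_f t).
Proof. by rewrite sub0r tt_d. Qed.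

Definition three_term_cell X Y Z (t : three_term X Y Z) :
    dgcell (cocval (tt_g t) \00 cocval (tt_f t)) 0 :=
  DGCell (three_term_cell_d t).

Definition cell_three_term X Y Z (f : zmor X Y) (g : zmor Y Z)
    (eps : dgcell (cocval g \00 cocval f) 0) : three_term X Y Z :=
  ThreeTerm (etrans (cell_d eps) (sub0r _)).

Lemma left_exact_kernel21 X Y Z (t : three_term X Y Z) :
  left_exact t <->
  @is_kernel21 (dgcat_SCG A_strict) _ _ _ _ _ (three_term_cell t).
Proof.
by split=> [/left_exactP H | /is_kernel21P H];
   [apply/is_kernel21P | apply/left_exactP].
Qed.

Lemma right_exact_cokernel21 X Y Z (t : three_term X Y Z) :
  right_exact t <->
  @is_cokernel21 (dgcat_SCG A_strict) _ _ _ _ _ (three_term_cell t).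
Proof.
by split=> [/right_exactP H | /is_cokernel21P H];
   [apply/is_cokernel21P | apply/right_exactP].
Qed.

End StrictTruncated.

Theorem theorem5 (k : comPzRingType) (A : dgcat k)
    (A_strict : strict_truncated2 A) :
  abelian_truncated2 A <-> relatively_exact (dgcat_SCG A_strict).
Proof.
split=> [[_ [[Z Z0] biprod] ker coker mono epi] |
         [[[Z Z0] prod _] ker coker mono epi]].
  split.
  - split.
    + by exists Z; apply/zero_object21P.
    + move=> X Y; have [P [i1 [i2 [p1 [p2]]]]] := biprod X Y.
      (* Passing to representatives brings the biproduct into the form read by [is_hbiproductP]. *)
      rewrite -[i1]creprK -[i2]creprK -[p1]creprK -[p2]creprK.
      move=> /is_hbiproductP hb; exists P, (cocval (crepr p1)), (cocval (crepr p2)).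
      exact: hbiproduct_product21 hb.
    + move=> X Y; have [P [i1 [i2 [p1 [p2]]]]] := biprod X Y.
      rewrite -[i1]creprK -[i2]creprK -[p1]creprK -[p2]creprK.
      move=> /is_hbiproductP hb; exists P, (cocval (crepr i1)), (cocval (crepr i2)).
      exact: hbiproduct_coproduct21 hb.
  - move=> X Y f; have [K [[i g h dh] [/= gE t_left]]] := ker X Y (zmor_of f).
    subst g; exists K, (cocval i), (three_term_cell (ThreeTerm dh)).
    exact: (left_exact_kernel21 A_strict _).1 t_left.
  - move=> X Y f; have [C [[g p h dh] [/= gE t_right]]] := coker X Y (zmor_of f).
    subst g; exists C, (cocval p), (three_term_cell (ThreeTerm dh)).
    exact: (right_exact_cokernel21 A_strict _).1 t_right.
  - move=> X Y f /faithful21P f_faithful C c eps /is_cokernel21P c_coker.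
    (* The cell [eps] makes [f] the first map of a right exact complex; [mono] makes it short exact,
       and its left half is the kernel property. *)
    pose t := @cell_three_term _ _ _ _ _ (zmor_of f) (zmor_of c) eps.
    apply/is_kernel21P/(left_exactP A_strict t).
    apply: (mono _ _ _ t _ _).1; first exact/(right_exactP A_strict).
    exact/(mono2P A_strict).
  - move=> X Y f /cofaithful21P f_cofaithful K i eps /is_kernel21P i_ker.
    pose t := @cell_three_term _ _ _ _ _ (zmor_of i) (zmor_of f) eps.
    apply/is_cokernel21P/(right_exactP A_strict t).
    apply: (epi _ _ _ t _ _).2; first exact/(left_exactP A_strict).
    exact/(epi2P A_strict).
split.
- move=> X Y i i_le c; rewrite -[c]creprK.
  rewrite -cls0; congr cls; apply: val_inj.
  by rewrite [LHS]A_strict // [RHS]A_strict.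
- split; first by exists Z; exact: (zero_object21P A_strict Z).1 Z0.
  move=> X Y; have [P [p1 [p2 /product21_hbiproduct[i1 [i2 hb]]]]] := prod X Y.
  exists P, (cls (zmor_of i1)), (cls (zmor_of i2)).
  exists (cls (zmor_of p1)), (cls (zmor_of p2)).
  exact/is_hbiproductP.
- move=> X Y f; have [K [i [eps eps_ker]]] := ker X Y (cocval f).
  exists K, (@cell_three_term _ _ _ _ _ (zmor_of i) f eps); split=> //.
  exact/(left_exactP A_strict)/(is_kernel21P A_strict eps).
- move=> X Y f; have [C [p [eps eps_coker]]] := coker X Y (cocval f).
  exists C, (@cell_three_term _ _ _ _ _ f (zmor_of p) eps); split=> //.
  exact/(right_exactP A_strict)/(is_cokernel21P A_strict eps).
(* Faithfulness of [tt_f t] turns the 2-cokernel [three_term_cell t] into a 2-kernel, which supplies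
   left exactness. *)
- move=> X Y W t t_right f_mono; split=> //; apply/(left_exact_kernel21 A_strict).
  apply: mono; first exact/faithful21P/(mono2P A_strict).
  exact/right_exact_cokernel21.
- move=> X Y W t t_left g_epi; split=> //; apply/(right_exact_cokernel21 A_strict).
  apply: epi; first exact/cofaithful21P/(epi2P A_strict).
  exact/left_exact_kernel21.
Qed.
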